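(* Assume $\rho^0\in\mathcal M^+_2(\Omega)$, $\mathcal F(\rho^0)<\infty$ and $\mathcal F$ is bounded from below on $\mathcal M^+(\Omega)$. Let $\rho^\tau,\tilde\rho^\tau$ be the interpolated curves produced by the splitting scheme starting from $\rho^0$, and let $\tau\to0$ be a discrete sequence and $\rho\in\mathcal C^{1/2}([0,\infty);(\mathcal M^+(\Omega),\mathtt{KFR}))$ be a curve such that $\rho^\tau(t)\to\rho(t)$ and $\tilde\rho^\tau(t)\to\rho(t)$ weakly-$\ast$ for every $t\ge 0$ along this sequence. Assume that, along this sequence, $$\tilde\rho^\tau\nabla\big(U'(\tilde\rho^\tau)+\Psi+K\star\tilde\rho^\tau\big)\rightharpoonup \rho\nabla\big(U'(\rho)+\Psi+K\star\rho\big),$$ $$\sqrt{\rho^\tau}\,\frac{\sqrt{\rho^\tau}+\sqrt{\tilde\rho^\tau}}{2}\,\big(U'(\rho^\tau)+\Psi+K\star\rho^\tau\big)\rightharpoonup\rho\big(U'(\rho)+\Psi+K\star\rho\big)$$ weakly in $L^1_{\mathrm{loc}}((0,\infty)\times\Omega)$. Then $\rho$ is a nonnegative weak solution of $$\begin{cases}\partial_t\rho=\operatorname{div}\big(\rho\nabla(U'(\rho)+\Psi+K\star\rho)\big)-\rho\,(U'(\rho)+\Psi+K\star\rho)&\text{in }(0,\infty)\times\Omega,\\ \rho|_{t=0}=\rho^0&\text{in }\mathcal M^+(\Omega).\end{cases}$$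
   Context: $\Omega\subset\mathbb R^d$ is a convex (open) set, possibly unbounded. $\mathcal M^+=\mathcal M^+(\Omega)$ is the set of finite nonnegative Radon measures on $\Omega$, $|\rho|$ is the total mass of $\rho$, and $\mathcal M^+_2$ is the subset of measures with finite second moment. Weak-$\ast$ convergence is in duality with $\mathcal C_0(\Omega)$. An absolutely continuous measure is identified with its Lebesgue density. Distances. For $\rho_0,\rho_1\in\mathcal M_2^+$ with equal mass, $\mathtt{MK}^2(\rho_0,\rho_1)=\min_\gamma\int_{\Omega\times\Omega}|x-y|^2\,d\gamma(x,y)$ over nonnegative measures $\gamma$ on $\Omega\times\Omega$ with marginals $\rho_0,\rho_1$. For $\rho_0,\rho_1\in\mathcal M^+$, $\mathtt{FR}^2(\rho_0,\rho_1)=4\int_\Omega\big|\sqrt{d\rho_0/d\lambda}-\sqrt{d\rho_1/d\lambda}\big|^2d\lambda$, with $\lambda$ any reference measure dominating $\rho_0,\rho_1$. For $\rho_0,\rho_1\in\mathcal M^+$, $\mathtt{KFR}^2(\rho_0,\rho_1)=\inf\int_0^1\int_\Omega(|\mathbf v_t|^2+|r_t|^2)\,d\rho_t\,dt$ over curves $t\in[0,1]\mapsto(\rho_t,\mathbf v_t,r_t)\in\mathcal M^+\times L^2(\Omega,d\rho_t)^d\times L^2(\Omega,d\rho_t)$ with $t\mapsto\rho_t$ narrowly continuous with endpoints $\rho_0,\rho_1$ and $\partial_t\rho_t+\operatorname{div}(\rho_t\mathbf v_t)=\rho_tr_t$ in $\mathcal D'((0,1)\times\Omega)$. Energy. Given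 an internal energy $U:[0,\infty)\to\mathbb R$, an external potential $\Psi:\Omega\to\mathbb R$ and an interaction kernel $K$ (with $K\star\rho(x)=\int_\Omega K(x-y)\rho(y)\,dy$), $\mathcal F(\rho)=\int_\Omega\{U(\rho)+\Psi\rho+\tfrac12\rho\,K\star\rho\}\,dx$ if $\rho\ll dx$ and $\mathcal F(\rho)=+\infty$ otherwise. Splitting scheme. For a time step $\tau>0$ and $n\ge0$, successively $$\rho^{n+\frac12}\in\operatorname{Argmin}_{\rho\in\mathcal M_2^+,\,|\rho|=|\rho^n|}\Big\{\tfrac1{2\tau}\mathtt{MK}^2(\rho,\rho^n)+\mathcal F(\rho)\Big\},\qquad \rho^{n+1}\in\operatorname{Argmin}_{\rho\in\mathcal M^+}\Big\{\tfrac1{2\tau}\mathtt{FR}^2(\rho,\rho^{n+\frac12})+\mathcal F(\rho)\Big\}.$$ It is assumed that these problems can be solved recursively with absolutely continuous minimizers (and $\rho^{n}\in\mathcal M^+_2$ for all $n$). The interpolated curves are, for $t\in((n-1)\tau,n\tau]$, $n\ge0$, $t\geq 0$: $\tilde\rho^\tau(t)=\rho^{n+\frac12}$ and $\rho^\tau(t)=\rho^{n+1}$. Standing assumption: $U,\Psi,K$ are such that $U'(\rho)+\Psi+K\star\rho$ is the first variation of $\mathcal F$ and the minimizers satisfy the Euler-Lagrange equations of the two substeps: for all $\zeta\in\mathcal C_c^\infty(\Omega;\mathbb R^d)$, $$\int_\Omega\frac{\mathrm{id}-\mathbf t}{\tau}\cdot\zeta\,d\rho^{n+\frac12}+\int_\Omega\nabla\big(U'(\rho^{n+\frac12})+\Psi+K\star\rho^{n+\frac12}\big)\cdot\zeta\,d\rho^{n+\frac12}=0,$$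 where $\mathbf t$ is the optimal transport map from $\rho^{n+\frac12}$ to $\rho^n$ for $\mathtt{MK}$; and for all $\phi\in\mathcal C_c^\infty(\Omega)$, $$\int_\Omega(\rho^{n+1}-\rho^{n+\frac12})\phi=-\tau\int_\Omega\frac{\sqrt{\rho^{n+1}}(\sqrt{\rho^{n+1}}+\sqrt{\rho^{n+\frac12}})}2\big\{U'(\rho^{n+1})+\Psi+K\star\rho^{n+1}\big\}\phi.$$ Weak solution means: for all $0<t_1<t_2$ and $\phi\in\mathcal C^\infty_c(\Omega)$, $$\int_\Omega(\rho(t_2)-\rho(t_1))\phi=-\int_{t_1}^{t_2}\int_\Omega\rho\Big(\nabla(U'(\rho)+\Psi+K\star\rho)\cdot\nabla\phi+(U'(\rho)+\Psi+K\star\rho)\phi\Big)dx\,dt,$$ and the initial datum is taken in the sense that $\rho(0)=\rho^0$ with $t\mapsto\rho(t)$ continuous on $[0,\infty)$ for the metric $\mathtt{KFR}$. *)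

(* Defs.v *)
From HB Require Import structures.
From mathcomp Require Import all_boot all_order all_algebra.
From mathcomp Require Import all_classical all_reals all_analysis.

Set Implicit Arguments.
Unset Strict Implicit.
Unset Printing Implicit Defensive.

Import Order.TTheory GRing.Theory Num.Theory.
Import numFieldNormedType.Exports.

Local Open Scope classical_set_scope.
Local Open Scope ring_scope.
Local Open Scope ereal_scope.
Local Open Scope charge_scope.

Fact rV_display : measure_display. Proof. exact: default_measure_display. Qed.

(* The Borel sigma-algebra of R^d, presented as the product sigma-algebra (the
   one generated by the coordinates), as the library does for pairs and
   tuples. *)
Section measurable_rV.
Context {R : realType} {d : nat}.

Let coords : 'I_d -> 'rV[R]_d -> measurableTypeR R := fun i v => v ord0 i.

Let rV_set0 : g_sigma_preimage coords set0.
Proof. exact: sigma_algebra0. Qed.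

Let rV_setC A : g_sigma_preimage coords A -> g_sigma_preimage coords (~` A).
Proof. exact: sigma_algebraC. Qed.

Let rV_bigcup (F : (set 'rV[R]_d)^nat) :
  (forall i, g_sigma_preimage coords (F i)) ->
  g_sigma_preimage coords (\bigcup_i (F i)).
Proof. exact: sigma_algebra_bigcup. Qed.

HB.instance Definition _ := @isMeasurable.Build rV_display
  'rV[R]_d (g_sigma_preimage coords) rV_set0 rV_setC rV_bigcup.

Lemma measurable_coord (i : 'I_d) :
  measurable_fun [set: 'rV[R]_d] (fun v => v ord0 i : measurableTypeR R).
Proof.
move=> _ Y mY; rewrite setTI; apply: sub_sigma_algebra => /=.
rewrite -bigcup_seq/=; exists i => /=; first by rewrite mem_index_enum.
by exists Y => //; rewrite setTI.
Qed.

Lemma measurable_fun_rVP d1 (T : measurableType d1) (f : T -> 'rV[R]_d) :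
  (forall i, measurable_fun [set: T]
               (fun x => f x ord0 i : measurableTypeR R)) ->
  measurable_fun [set: T] f.
Proof.
move=> mf.
suff H : g_sigma_preimage (fun i x => coords i (f x)) `<=` measurable.
  move=> _ A mA; rewrite setTI; apply: H.
  rewrite (_ : (fun i x => coords i (f x)) = (fun i => coords i \o f)) //.
  by rewrite g_sigma_preimage_comp; exists A => //; rewrite setTI.
apply: smallest_sub; first exact: sigma_algebra_measurable.
move=> A; rewrite -bigcup_seq/= => -[i _] [B mB <-].
exact: mf.
Qed.

End measurable_rV.

Section lebesgue_rV.
Context {R : realType}.

Definition consv n (p : measurableTypeR R * 'rV[R]_n) : 'rV[R]_n.+1 :=
  \row_i if unlift ord0 i is Some j then p.2 ord0 j else p.1.

Definition unconsv n (v : 'rV[R]_n.+1) : measurableTypeR R * 'rV[R]_n :=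
  (v ord0 ord0, \row_j v ord0 (lift ord0 j)).

Lemma consvK n : cancel (@consv n) (@unconsv n).
Proof.
move=> [a v]; rewrite /consv /unconsv /=; congr pair.
  by rewrite mxE unlift_none.
by apply/rowP => j; rewrite !mxE liftK.
Qed.

Lemma measurable_consv n : measurable_fun setT (@consv n).
Proof.
apply: measurable_fun_rVP => i.
case: (unliftP ord0 i) => [j ->|->].
  rewrite (_ : (fun _ => _) = (fun v : 'rV[R]_n => v ord0 j) \o snd).
    exact: measurableT_comp (measurable_coord _) measurable_snd.
  by apply/funext => -[a v]; rewrite /consv /= mxE liftK.
rewrite (_ : (fun _ => _) = fst); first exact: measurable_fst.
by apply/funext => -[a v]; rewrite /consv /= mxE unlift_none.
Qed.

Lemma measurable_unconsv n : measurable_fun setT (@unconsv n).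
Proof.
have mt : measurable_fun setT (fun v : 'rV[R]_n.+1 => \row_j v ord0 (lift ord0 j)).
  apply: measurable_fun_rVP => i /=.
  rewrite (_ : (fun _ => _) = (fun v : 'rV[R]_n.+1 => v ord0 (lift ord0 i))).
    exact: measurable_coord.
  by apply/funext => v; rewrite mxE.
exact: (measurable_fun_pair (measurable_coord ord0) mt).
Qed.

Section step.
Variables (n : nat) (mu : {sigma_finite_measure set 'rV[R]_n -> \bar R}).

Definition lebesgue_cons : set 'rV[R]_n.+1 -> \bar R :=
  pushforward (@lebesgue_measure R \x mu) (@consv n).

Let lebesgue_cons0 : lebesgue_cons set0 = 0.
Proof. by rewrite /lebesgue_cons /pushforward preimage_set0 measure0. Qed.

Let lebesgue_cons_ge0 A : 0 <= lebesgue_cons A.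
Proof. by rewrite /lebesgue_cons /pushforward measure_ge0. Qed.

Let lebesgue_cons_sigma_additive : semi_sigma_additive lebesgue_cons.
Proof.
move=> F mF tF mUF; rewrite /lebesgue_cons /pushforward preimage_bigcup.
apply: measure_semi_sigma_additive.
- by move=> k; rewrite -[X in measurable X]setTI; exact: measurable_consv.
- apply/trivIsetP => /= i j _ _ ij; rewrite -preimage_setI.
  by move/trivIsetP : tF => /(_ _ _ _ _ ij) ->//; rewrite preimage_set0.
- by rewrite -preimage_bigcup -[X in measurable X]setTI; exact: measurable_consv.
Qed.

HB.instance Definition _ := isMeasure.Build _ _ _ lebesgue_cons
  lebesgue_cons0 lebesgue_cons_ge0 lebesgue_cons_sigma_additive.

Let lebesgue_cons_sigma_finite : sigma_finite setT lebesgue_cons.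
Proof.
have /sigma_finiteP[F [FT ndF Foo]] := sigma_finiteT (@lebesgue_measure R).
have /sigma_finiteP[G [GT ndG Goo]] := sigma_finiteT mu.
exists (fun k => @unconsv n @^-1` (F k `*` G k)).
  rewrite predeqE => v; split=> // _.
  have [k _ Fk] : (\bigcup_i F i) (unconsv v).1 by rewrite -FT.
  have [l _ Gl] : (\bigcup_i G i) (unconsv v).2 by rewrite -GT.
  exists (maxn k l) => //; split.
  - by move: Fk; exact/subsetPset/ndF/leq_maxl.
  - by move: Gl; exact/subsetPset/ndG/leq_maxr.
move=> k; have [mF Fk] := Foo k; have [mG Gk] := Goo k; split.
  rewrite -[X in measurable X]setTI; apply: measurable_unconsv => //.
  exact: measurableX.
rewrite /lebesgue_cons /pushforward -comp_preimage.
rewrite (_ : _ \o _ = id); last by apply/funext => p /=; rewrite consvK.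
by rewrite preimage_id product_measure1E// lte_mul_pinfty// ge0_fin_numE.
Qed.

HB.instance Definition _ := Measure_isSigmaFinite.Build _ _ _ lebesgue_cons
  lebesgue_cons_sigma_finite.

End step.

Fixpoint lebesgue_rV (n : nat) : {sigma_finite_measure set 'rV[R]_n -> \bar R} :=
  match n with
  | 0%N => \d_(0 : 'rV[R]_0)%R
  | m.+1 => lebesgue_cons (lebesgue_rV m)
  end.

End lebesgue_rV.

Section euclidean.
Context {R : realType} {d : nat}.
Implicit Types x y : 'rV[R]_d.

(* The library norm on 'rV[R]_d is the sup norm; Euclidean quantities are
   expressed with these two. *)
Definition dotv x y : R := (\sum_(i < d) x ord0 i * y ord0 i)%R.
Definition sqnorm x : R := dotv x x.

Definition grad (f : 'rV[R]_d -> R) x : 'rV[R]_d :=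
  \row_i 'D_(delta_mx ord0 i) f x.

End euclidean.

(* C^oo: all iterated directional derivatives exist and are continuous. *)
Definition smooth {R : realType} {V : normedModType R} (f : V -> R) :=
  forall s : seq V, let g := foldr (fun v (h : V -> R) => 'D_v h) f s in
    (forall x v, derivable g x v) /\ continuous g.

(* C^oo_c(O), functions being extended by 0 outside the open set O. *)
Definition test_fun {R : realType} {V : normedModType R} (O : set V)
    (f : V -> R) :=
  smooth f /\
  exists Q : set V, [/\ compact Q, Q `<=` O & forall x, ~ Q x -> f x = 0%R].

Section measures.
Context {R : realType} {d : nat}.
Local Notation E := 'rV[R]_d.
Local Notation fmeas := {finite_measure set E -> \bar R}.
Implicit Types (O : set E) (mu nu : fmeas).

(* Measures on O are represented by the measures on R^d that do not charge the
   complement of O; finite Borel measures on R^d are Radon. *)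
Definition Mplus O : set fmeas := [set mu | mu (~` O) = 0].

Definition Mplus2 O : set fmeas :=
  [set mu | Mplus O mu /\ \int[mu]_(x in O) (sqnorm x)%:E < +oo].

Definition meas_eq mu nu := forall A, measurable A -> mu A = nu A.

Definition weak_star_cvg O (mu_ : nat -> fmeas) mu :=
  forall f : E -> R,
    {within O, continuous f} ->
    (forall e : R, (0 < e)%R -> exists Q, [/\ compact Q, Q `<=` O &
       forall x, O x -> ~ Q x -> (`|f x| < e)%R]) ->
    \int[mu_ n]_(x in O) (f x)%:E @[n --> \oo] --> \int[mu]_(x in O) (f x)%:E.

Definition coupling mu nu (g : {measure set (E * E) -> \bar R}) :=
  forall A, measurable A -> g (A `*` setT) = mu A /\ g (setT `*` A) = nu A.

Definition MK2 mu nu : \bar R :=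
  ereal_inf [set \int[g]_p (sqnorm (p.1 - p.2))%:E | g in coupling mu nu].

Definition optimal_map (T : E -> E) mu nu :=
  [/\ measurable_fun setT T,
      forall A, measurable A -> mu (T @^-1` A) = nu A
    & \int[mu]_x (sqnorm (x - T x))%:E = MK2 mu nu].

Section reference_measure.
Variables mu nu : fmeas.

Definition reference : set E -> \bar R := measure_add mu nu.

HB.instance Definition _ := Measure.on reference.

Let reference_fin : fin_num_fun reference.
Proof.
by move=> A mA; rewrite /reference measure_addE fin_numD !fin_num_measure.
Qed.

HB.instance Definition _ :=
  Measure_isFinite.Build _ _ _ reference reference_fin.

End reference_measure.

(* The integral does not depend on the choice of the dominating measure; the
   reference measure used here is mu + nu. *)
Definition FR2 O mu nu : \bar R :=
  let lam := reference mu nu in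
  let root (m : fmeas) x :=
    Num.sqrt (fine ('d (charge_of_finite_measure m) '/d lam x)) in
  4%:E * \int[lam]_(x in O) ((root mu x - root nu x) ^+ 2)%:E.

Definition narrowly_continuous O (mu : R -> fmeas) :=
  forall f : E -> R, {within O, continuous f} ->
    (exists M : R, forall x, O x -> (`|f x| <= M)%R) ->
    {within `[0%R, 1%R]%classic,
      continuous (fun t : R => \int[mu t]_(x in O) (f x)%:E)}.

Definition continuity_equation O (mu : R -> fmeas) (v : R -> E -> E)
    (r : R -> E -> R) :=
  forall psi : R * E -> R,
    test_fun [set p : R * E | (0 < p.1 < 1)%R /\ O p.2] psi ->
    \int[lebesgue_measure]_(t in `]0%R, 1%R[) \int[mu t]_(x in O)
      ((fun s => psi (s, x))^`()%classic t
       + dotv (v t x) (grad (fun y => psi (t, y)) x)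
       + r t x * psi (t, x))%:E = 0.

Definition KFR_curve O mu0 mu1 (mu : R -> fmeas) (v : R -> E -> E)
    (r : R -> E -> R) :=
  [/\ (forall t, (0 <= t <= 1)%R -> Mplus O (mu t)),
      narrowly_continuous O mu,
      meas_eq (mu 0%R) mu0 /\ meas_eq (mu 1%R) mu1,
      [/\ (forall i, measurable_fun
             (`[0%R, 1%R]%classic `*` O : set (measurableTypeR R * E))
             (fun p => v p.1 p.2 ord0 i)),
          measurable_fun
             (`[0%R, 1%R]%classic `*` O : set (measurableTypeR R * E))
             (fun p => r p.1 p.2)
        & forall t, (0 <= t <= 1)%R ->
            \int[mu t]_(x in O) (sqnorm (v t x) + r t x ^+ 2)%:E < +oo]
    & continuity_equation O mu v r].

Definition KFR2 O mu0 mu1 : \bar R :=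
  ereal_inf [set a | exists (mu : R -> fmeas) v r,
    KFR_curve O mu0 mu1 mu v r /\
    a = \int[lebesgue_measure]_(t in `[0%R, 1%R])
          \int[mu t]_(x in O) (sqnorm (v t x) + r t x ^+ 2)%:E].

Definition KFR O mu0 mu1 : \bar R := sqrte (KFR2 O mu0 mu1).

Definition KFR_holder_half O (rho : R -> fmeas) :=
  exists C : R, forall s t, (0 <= s)%R -> (0 <= t)%R ->
    KFR O (rho s) (rho t) <= (C * Num.sqrt `|s - t|)%:E.

Definition KFR_continuous O (rho : R -> fmeas) :=
  forall t, (0 <= t)%R ->
    KFR O (rho s) (rho t) @[s --> within [set s : R | (0 <= s)%R] (nbhs t)]
      --> 0.

End measures.

Section energy.
Context {R : realType} {d : nat}.
Local Notation E := 'rV[R]_d.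
Local Notation fmeas := {finite_measure set E -> \bar R}.
Local Notation leb := (@lebesgue_rV R d).
Variables (O : set E) (U : R -> R) (Psi K : E -> R).

Definition dens (mu : fmeas) (x : E) : R :=
  fine ('d (charge_of_finite_measure mu) '/d leb x).

Definition conv (u : E -> R) (x : E) : \bar R :=
  \int[leb]_(y in O) (K (x - y) * u y)%:E.

Definition energy_dens (u : E -> R) : \bar R :=
  \int[leb]_(x in O)
    ((U (u x))%:E + (Psi x * u x)%:E + (2^-1 * u x)%:E * conv u x).

Definition energy (mu : fmeas) : \bar R :=
  if pselect (mu `<< leb) then energy_dens (dens mu) else +oo.

(* U is an internal energy on [0, +oo[: its values on ]-oo, 0[ are irrelevant.
   The derivative at 0 is one-sided and may be infinite, e.g. -oo for
   U z = z ln z. *)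
Definition quot0 (h : R) : \bar R := ((U h - U 0) / h)%:E.

Definition dU (z : R) : \bar R :=
  if (0 < z)%R then (U^`()%classic z)%:E else lim (quot0 h @[h --> 0^'+]).

Definition differentiable_energy :=
  (forall z, (0 < z)%R -> derivable U z 1%R) /\ cvg (quot0 h @[h --> 0^'+]).

Definition potential (u : E -> R) (x : E) : \bar R :=
  dU (u x) + (Psi x)%:E + conv u x.

(* [potential u] is the first variation of the energy at every density u of
   finite energy, along every bounded compactly supported perturbation chi for
   which u + e chi remains a density of finite energy. *)
Definition first_variation :=
  forall u chi : E -> R,
    (forall x, O x -> (0 <= u x)%R) -> leb.-integrable O (EFin \o u) ->
    energy_dens u \is a fin_num ->
    measurable_fun setT chi -> (exists M, forall x, (`|chi x| <= M)%R) ->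
    (exists Q, [/\ compact Q, Q `<=` O & forall x, ~ Q x -> chi x = 0%R]) ->
    (exists2 e0 : R, (0 < e0)%R & forall e, (0 < e <= e0)%R ->
       (forall x, O x -> (0 <= u x + e * chi x)%R) /\
       energy_dens (fun x => u x + e * chi x)%R \is a fin_num) ->
    leb.-integrable O (fun x => potential u x * (chi x)%:E) ->
    (e^-1)%:E * (energy_dens (fun x => u x + e * chi x)%R - energy_dens u)
      @[e --> 0^'+]
    --> \int[leb]_(x in O) (potential u x * (chi x)%:E).

Definition argmin (A : set fmeas) (J : fmeas -> \bar R) : set fmeas :=
  [set m | A m /\ forall m', A m' -> J m <= J m'].

Definition splitting_scheme (tau : R) (rho0 : fmeas) (rho rhoh : nat -> fmeas) :=
  rho 0%N = rho0 /\
  forall n,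
    [/\ Mplus2 O (rho n),
        argmin [set m | Mplus2 O m /\ m setT = rho n setT]
          (fun m => ((2 * tau)^-1)%:E * MK2 m (rho n) + energy m) (rhoh n),
        rhoh n `<< leb,
        argmin (Mplus O)
          (fun m => ((2 * tau)^-1)%:E * FR2 O m (rhoh n) + energy m) (rho n.+1)
      & rho n.+1 `<< leb].

Definition locally_integrable (w : E -> \bar R) :=
  forall Q, compact Q -> Q `<=` O -> leb.-integrable Q w.

Definition weak_grad (w : E -> \bar R) (G : E -> E) :=
  [/\ locally_integrable w,
      forall i, locally_integrable (fun x => (G x ord0 i)%:E)
    & forall phi, test_fun O phi -> forall i : 'I_d,
        \int[leb]_(x in O) (w x * (grad phi x ord0 i)%:E) =
        - \int[leb]_(x in O) (G x ord0 i * phi x)%:E].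

Definition euler_lagrange_MK (tau : R) (rho rhoh : fmeas) (G : E -> E) :=
  weak_grad (potential (dens rhoh)) G /\
  exists2 T : E -> E, optimal_map T rhoh rho &
    forall zeta : E -> E, (forall i, test_fun O (fun x => zeta x ord0 i)) ->
      \int[rhoh]_(x in O) (dotv (tau^-1 *: (x - T x)) (zeta x))%:E
      + \int[rhoh]_(x in O) (dotv (G x) (zeta x))%:E = 0.

Definition reaction (u uh : E -> R) (x : E) : \bar R :=
  (Num.sqrt (u x) * (Num.sqrt (u x) + Num.sqrt (uh x)) / 2)%:E * potential u x.

Definition euler_lagrange_FR (tau : R) (rhoh rho1 : fmeas) :=
  forall phi, test_fun O phi ->
    \int[leb]_(x in O) ((dens rho1 x - dens rhoh x) * phi x)%:E =
    - (tau%:E *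
       \int[leb]_(x in O) (reaction (dens rho1) (dens rhoh) x * (phi x)%:E)).

(* t |-> s n for t in ](n - 1) tau, n tau] *)
Definition interpolate {X : Type} (tau : R) (s : nat -> X) (t : R) : X :=
  s `|Num.ceil (t / tau)|%N.

Definition spacetime : set (measurableTypeR R * E) :=
  [set p | (0 < p.1)%R /\ O p.2].

Definition L1loc (f : measurableTypeR R * E -> \bar R) :=
  forall Q : set (R * E), compact Q -> Q `<=` spacetime ->
    (@lebesgue_measure R \x leb).-integrable Q f.

Definition weak_L1loc_cvg (f_ : nat -> measurableTypeR R * E -> \bar R)
    (f : measurableTypeR R * E -> \bar R) :=
  [/\ forall k, L1loc (f_ k), L1loc f
    & forall (Q : set (R * E)) (g : measurableTypeR R * E -> R),
        compact Q -> Q `<=` spacetime -> measurable_fun setT g ->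
        (exists M, forall p, (`|g p| <= M)%R) ->
        \int[@lebesgue_measure R \x leb]_(p in Q) (f_ k p * (g p)%:E)
          @[k --> \oo]
        --> \int[@lebesgue_measure R \x leb]_(p in Q) (f p * (g p)%:E)].

(* u is a (jointly measurable) density of the curve rho and G t the gradient of
   the potential of u t, for almost every positive time *)
Definition density_gradient (rho : R -> fmeas) (u : R -> E -> R)
    (G : R -> E -> E) :=
  measurable_fun spacetime (fun p => u p.1 p.2) /\
  {ae @lebesgue_measure R, forall t, (0 < t)%R ->
    [/\ forall x, O x -> (0 <= u t x)%R,
        forall A, measurable A -> rho t A = \int[leb]_(x in A `&` O) (u t x)%:E
      & weak_grad (potential (u t)) (G t)]}.

Definition weak_solution (rho0 : fmeas) (rho : R -> fmeas) :=
  [/\ forall t, (0 <= t)%R -> Mplus O (rho t),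
      exists (u : R -> E -> R) (G : R -> E -> E),
        density_gradient rho u G /\
        forall (t1 t2 : R) (phi : E -> R),
          (0 < t1)%R -> (t1 < t2)%R -> test_fun O phi ->
          let integrand t x :=
            (u t x * dotv (G t x) (grad phi x))%:E
            + (u t x)%:E * potential (u t) x * (phi x)%:E in
          (@lebesgue_measure R \x leb).-integrable
            (`]t1, t2[%classic `*` O) (fun p => integrand p.1 p.2) /\
          \int[rho t2]_(x in O) (phi x)%:E - \int[rho t1]_(x in O) (phi x)%:E =
          - \int[lebesgue_measure]_(t in `]t1, t2[) \int[leb]_(x in O)
              integrand t x,
      meas_eq (rho 0%R) rho0
    & KFR_continuous O rho].

End energy.

(* Main.v *)
Require Import Defs.
From HB Require Import structures.
From mathcomp Require Import all_boot all_order all_algebra.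
From mathcomp Require Import all_classical all_reals all_analysis.
From mathcomp Require Import measurable_realfun ring lra.

Set Implicit Arguments.
Unset Strict Implicit.
Unset Printing Implicit Defensive.

Import Order.TTheory GRing.Theory Num.Theory.
Import numFieldNormedType.Exports.

Local Open Scope classical_set_scope.
Local Open Scope ring_scope.

(* Testing the two Euler-Lagrange equations with grad phi and phi, and Taylor
   expanding phi along the optimal maps, gives at step n
     int phi d(rho^{n+1} - rho^n) = - tau h_n + O(MK^2(rho^{n+1/2}, rho^n)),
   where h_n is the integral against grad phi and phi of the flux and of the
   reaction term. Comparing each minimizer with the previous iterate, the squared
   transport costs sum to at most 2 tau (F(rho^0) - inf F), so the remainders
   telescope to O(tau). The sum of the tau h_n is the time integral of the
   interpolated fluxes up to two incomplete steps: their reaction part is the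
   difference of int phi against the two interpolated curves at the end points,
   and their transport part is O(sqrt tau) by Young's inequality. The weak
   L^1_loc convergences then yield the weak formulation. At time 0 the curve
   takes the value rho^{1/2}, which is O(sqrt tau)-close to rho^0 on Lipschitz
   functions, and Lipschitz functions vanishing at infinity determine a measure
   on Omega. *)

(** * Borel sets and uniqueness of finite measures on R^d *)

Section borel_rV.
Context {R : realType} {d : nat}.
Local Notation E := 'rV[R]_d.

(** The sigma-algebra is generated by the coordinates, so openness must be reduced to them: [V] is
    the union of the boxes it contains that have a rational centre and half-side 1/(n+1). There are
    countably many such boxes, and each is a finite intersection of coordinate preimages of
    intervals. *)
Lemma open_measurable_rV (V : set E) : open V -> measurable V.
Proof.
move=> oV.
pose B (c : 'rV[rat]_d * nat) : set E := [set x : E |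
  forall i, `|ratr (c.1 ord0 i) - x ord0 i| < c.2.+1%:R^-1].
have mB c : measurable (B c).
  rewrite (_ : B c = \bigcap_(i in [set: 'I_d]) ((fun x : E => x ord0 i : measurableTypeR R) @^-1`
      ball (ratr (c.1 ord0 i) : R) c.2.+1%:R^-1)).
    apply: fin_bigcap_measurable => [|i _]; first exact: finite_finset.
    rewrite -[X in measurable X]setTI; apply: measurable_coord => //.
    by apply: open_measurable; apply: ball_open; rewrite invr_gt0 ltr0n.
  apply/seteqP; split => x Bx i; first by move=> _; exact: Bx.
  exact: (Bx i I).
pose F c := if `[< B c `<=` V >] then B c else set0.
have -> : V = \bigcup_c F c.
  apply/seteqP; split => [x Vx|x [c _]]; last first.
    by rewrite /F; case: asboolP => // + Bx; exact.
  have /nbhs_ballP[e /= e0 xeV] : nbhs x V by exact: open_nbhs_nbhs.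
  (* Half of [e], because [x] and a point [y] of the box are compared through the rational
     centre. *)
  have [n ne] : exists n, (n.+1%:R^-1 : R) < e / 2.
    have e20 : 0 < e / 2 by lra.
    by have [n _ /(_ n (leqnn _)) ne] := near_infty_natSinv_lt (PosNum e20); exists n.
  have /choice[q qx] : forall i : 'I_d, exists q : rat, `|ratr q - x ord0 i| < (n.+1%:R^-1 : R).
    move=> i.
    have /rat_in_itvoo[q] : x ord0 i - n.+1%:R^-1 < x ord0 i + n.+1%:R^-1.
      by have : 0 < n.+1%:R^-1 :> R; [rewrite invr_gt0 ltr0n|move: (n.+1%:R^-1) => r; lra].
    by rewrite in_itv/= => /andP[h1 h2]; exists q; rewrite ltr_distl h1 h2.
  exists (\row_i q i, n) => //; rewrite /F; case: asboolP => [|nB] /=.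
    by move=> _ i; rewrite mxE.
  exfalso; apply: nB => y /= By; apply: xeV; split=> // i j.
  rewrite (ord1 i) /ball/=; have := By j; rewrite mxE => Byj.
  have -> : x ord0 j - y ord0 j = (ratr (q j) - y ord0 j) - (ratr (q j) - x ord0 j) by ring.
  apply: le_lt_trans (ler_normB _ _) _; have := qx j.
  by move: (n.+1%:R^-1) ne Byj => r; lra.
apply: countable_bigcupT_measurable => // c.
by rewrite /F; case: asboolP.
Qed.

Lemma closed_measurable_rV (V : set E) : closed V -> measurable V.
Proof.
move=> cV; rewrite -(setCK V); apply: measurableC.
by apply: open_measurable_rV; exact: closed_openC.
Qed.

Lemma compact_measurable_rV (V : set E) : compact V -> measurable V.
Proof.
by move=> cV; apply: closed_measurable_rV; apply: compact_closed => //; exact: norm_hausdorff.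
Qed.

Lemma continuous_measurable_rV (f : E -> R) : continuous f ->
  measurable_fun setT (f : E -> measurableTypeR R).
Proof.
move=> /continuousP cf; apply: (measurability _ (RGenOpens.measurableE R)).
move=> _ [_ [a [b ->] <-]]; rewrite setTI; apply: open_measurable_rV.
exact/cf/interval_open.
Qed.

(** Open sets are stable under intersection, and they generate the whole sigma-algebra since the
    coordinates are continuous; finite measures that agree on such a class coincide. *)
Lemma measure_unique_open (mu nu : {finite_measure set E -> \bar R}) :
  (forall V, open V -> mu V = nu V) -> meas_eq mu nu.
Proof.
move=> H A mA.
have oE : @open E `<=` measurable by move=> V; exact: open_measurable_rV.
have cov : \bigcup_(k in [set: nat]) [set: E] = setT.
  by rewrite bigcup_const//; exists 0%N.
have sA : <<s @open E >> A.
  move: A mA; apply: smallest_sub; first exact: smallest_sigma_algebra.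
  move=> A; rewrite -bigcup_seq/= => -[i _] [B mB <-]; rewrite setTI.
  have mi : measurable_fun setT
      ((fun v => v ord0 i) : g_sigma_algebraType (@open E) -> measurableTypeR R).
    apply: (measurability _ (RGenOpens.measurableE R)).
    move=> _ [_ [a [b ->] <-]]; rewrite setTI; apply: sub_sigma_algebra.
    have /continuousP := @coord_continuous R 1 d ord0 i.
    by apply; exact: interval_open.
  by have := mi measurableT B mB; rewrite setTI.
have := (@g_sigma_algebra_measure_unique _ _ _ (@open E) oE (fun=> setT) _ cov mu nu _ H _ A sA).
move=> HH; apply: HH.
- by move=> _; exact: openT.
- by move=> V W; exact: openI.
- by move=> _; rewrite ltey_eq fin_num_measure.
Qed.

End borel_rV.

(** * Mean value and Taylor estimates from partial derivatives *)

Section coordinate_taylor.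
Context {R : realType} {d : nat}.
Local Notation E := 'rV[R]_d.
Implicit Types (f : E -> R) (x y v : E).

Lemma derivable_line f x v (r : R) : derivable f (x + r *: v) v ->
  is_derive r 1 (fun s => f (x + s *: v)) ('D_v f (x + r *: v)).
Proof.
move=> fv.
have eqq : (fun h : R => h^-1 *: (((fun s => f (x + s *: v)) \o shift r) (h *: 1) - f (x + r *: v))) =
  (fun h : R => h^-1 *: ((f \o shift (x + r *: v)) (h *: v) - f (x + r *: v))).
  apply/funext => h /=; congr (_ *: (f _ - _)).
  by rewrite scalerDl /= addrCA -[h *: 1]/(h * 1) mulr1.
by apply: DeriveDef; rewrite /derivable /derive eqq.
Qed.

(** The increment [s] may have either sign, so the intermediate point is located by [|c| <= |s|]
    rather than by an interval. *)
Lemma MVT_line f x v (s : R) : (forall y, derivable f y v) ->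
  exists2 c, `|c| <= `|s| & f (x + s *: v) - f x = s * 'D_v f (x + c *: v).
Proof.
move=> fv; set h : R -> R := fun s => f (x + s *: v).
have dh (r : R) : is_derive r 1 h ('D_v f (x + r *: v)) by exact: derivable_line.
have ch (a b : R) : {within `[a, b], continuous h}.
  by apply: derivable_within_continuous => r _; have [] := dh r.
have h0 : h 0 = f x by rewrite /h scale0r addr0.
have [s0|s0] := leP 0 s.
  have [c + hE] := @MVT_segment _ h (fun r => 'D_v f (x + r *: v)) 0 s s0 (fun r _ => dh r) (ch _ _).
  rewrite in_itv/= => /andP[c0 cs]; exists c; first by rewrite !ger0_norm.
  by rewrite -h0 -/(h s) hE subr0 mulrC.
have [c + hE] := @MVT_segment _ h (fun r => 'D_v f (x + r *: v)) s 0 (ltW s0) (fun r _ => dh r) (ch _ _).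
rewrite in_itv/= => /andP[sc c0]; exists c; first by rewrite !ler0_norm ?lerN2// ltW.
by rewrite -h0 -/(h s) -opprB hE sub0r mulrN opprK mulrC.
Qed.

Let e i : E := delta_mx ord0 i.

(** Staircase from [y] to [x] that changes one coordinate at a time: each leg is parallel to an
    axis, so partial derivatives suffice to control it. *)
Let path x y (k : nat) : E := \row_j (if (j < k)%N then x ord0 j else y ord0 j).

Let pathS x y (k : 'I_d) :
  path x y k.+1 = path x y k + (x ord0 k - y ord0 k) *: e k.
Proof.
apply/rowP => j; rewrite !mxE ltnS leq_eqVlt eqxx/=.
have [->|jk] := eqVneq j k; first by rewrite eqxx ltnn /=; ring.
by rewrite (negbTE (jk : (j : nat) != k)) /= mulr0 addr0.
Qed.

Let telescope_path f x y :
  f x - f y = \sum_(k < d) (f (path x y k.+1) - f (path x y k)).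
Proof.
rewrite -(big_mkord xpredT (fun k => f (path x y k.+1) - f (path x y k))).
rewrite telescope_sumr//; congr (f _ - f _); apply/rowP => j; rewrite mxE ?ltn_ord//.
Qed.

(** The l^1 norm, which is the length of the staircase path. *)
Definition norm1 x : R := \sum_(i < d) `|x ord0 i|.

Lemma lipschitz_partials f (M : R) : (forall i y, derivable f y (e i)) ->
  (forall i y, `|'D_(e i) f y| <= M) ->
  forall x y, `|f x - f y| <= M * norm1 (x - y).
Proof.
move=> fd fM x y; rewrite telescope_path /norm1 mulr_sumr.
apply: le_trans (ler_norm_sum _ _ _) _; apply: ler_sum => k _.
rewrite pathS; have [c _ ->] := MVT_line (path x y k) (x ord0 k - y ord0 k) (fd k).
by rewrite normrM mulrC !mxE ler_wpM2r.
Qed.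

(** Cauchy-Schwarz: the right-hand side is symmetrized into the double sum of (a_i^2 + a_j^2)/2,
    which dominates that of a_i a_j term by term. *)
Lemma norm1_sqnorm x : norm1 x ^+ 2 <= d%:R * sqnorm x.
Proof.
have -> : sqnorm x = \sum_(i < d) `|x ord0 i| ^+ 2.
  by apply: eq_bigr => i _; rewrite real_normK ?num_real ?expr2.
rewrite /norm1; set a := fun i => `|x ord0 i|.
rewrite -[leLHS]/((\sum_(i < d) a i) ^+ 2) -[leRHS]/(d%:R * \sum_(i < d) a i ^+ 2).
have -> : d%:R * \sum_(i < d) a i ^+ 2 =
    \sum_(i < d) \sum_(j < d) (2^-1 * (a i ^+ 2 + a j ^+ 2)).
  have -> : \sum_(i < d) \sum_(j < d) (2^-1 * (a i ^+ 2 + a j ^+ 2)) =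
      \sum_(i < d) 2^-1 * (d%:R * a i ^+ 2 + \sum_(j < d) a j ^+ 2).
    by apply: eq_bigr => i _; rewrite -mulr_sumr big_split/= sumr_const card_ord mulr_natl.
  rewrite -mulr_sumr big_split/= sumr_const card_ord -mulr_sumr.
  rewrite !mulr_natl; move: (_ *+ d) => z; lra.
rewrite expr2 mulr_suml; apply: ler_sum => i _; rewrite mulr_sumr; apply: ler_sum => j _.
by have := sqr_ge0 (a i - a j); rewrite sqrrB => H; lra.
Qed.

(** On each leg the mean value theorem yields a partial derivative of [f] at an intermediate point,
    whose l^1 distance to [x] is at most [2 * norm1 (x - y)]. Replacing it by the derivative at [x]
    costs the Lipschitz bound of that partial derivative. *)
Lemma taylor_partials f (M : R) : 0 <= M ->
  (forall i y, derivable f y (e i)) ->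
  (forall i j y, derivable ('D_(e i) f) y (e j)) ->
  (forall i j y, `|'D_(e j) ('D_(e i) f) y| <= M) ->
  forall x y, `|f x - f y - dotv (x - y) (grad f x)| <=
     (2 * M * d%:R) * sqnorm (x - y).
Proof.
move=> M0 fd fdd fM x y; rewrite telescope_path /dotv -sumrB.
apply: (@le_trans _ _ ((2 * M) * norm1 (x - y) ^+ 2)); last first.
  by rewrite -[leRHS]mulrA; apply: ler_wpM2l; [rewrite mulr_ge0|exact: norm1_sqnorm].
apply: le_trans (ler_norm_sum _ _ _) _.
rewrite expr2 mulrCA {1}/norm1 mulr_suml; apply: ler_sum => k _.
rewrite pathS; have [c cs ->] := MVT_line (path x y k) (x ord0 k - y ord0 k) (fd k).
rewrite !mxE -mulrBr normrM; apply: ler_wpM2l => //.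
apply: le_trans (lipschitz_partials (fdd k) (fM k) _ _) _.
rewrite (mulrC 2) -mulrA; apply: ler_wpM2l => //; rewrite /norm1 mulr_sumr.
apply: ler_sum => j _; rewrite !mxE eqxx /=.
have xy0 : 0 <= `|x ord0 j - y ord0 j| by [].
have [->|jk] := eqVneq j k.
  rewrite ltnn mulr1 (_ : _ - _ = c - (x ord0 k - y ord0 k)); last by ring.
  by apply: le_trans (ler_normB _ _) _; lra.
rewrite mulr0 addr0; case: ifP => _; first by rewrite subrr normr0; lra.
by rewrite distrC; lra.
Qed.

End coordinate_taylor.

(** * Bounds and Taylor expansion for test functions *)

Section test_functions.
Context {R : realType} {d : nat}.
Local Notation E := 'rV[R]_d.
Variable O : set E.
Implicit Types (f : E -> R) (x y v : E).

Definition compact_support f :=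
  exists Q, [/\ compact Q, Q `<=` O & forall x, ~ Q x -> f x = 0].

Lemma test_fun_continuous f : test_fun O f -> continuous f.
Proof. by case=> /(_ [::])[_]. Qed.

Lemma test_fun_derivable f x v : test_fun O f -> derivable f x v.
Proof. by case=> /(_ [::])[+ _] _; apply. Qed.

Lemma test_fun_support f : test_fun O f -> compact_support f.
Proof. by case. Qed.

Lemma derive_off_compact f (Q : set E) v x : compact Q ->
  (forall y, ~ Q y -> f y = 0) -> ~ Q x -> 'D_v f x = 0.
Proof.
move=> cQ Qf Qx; rewrite (@near_eq_derive _ _ _ f (cst 0)) ?derive_cst//.
have cF : closed Q by apply: compact_closed => //; exact: norm_hausdorff.
have : nbhs x (~` Q) by apply: open_nbhs_nbhs; split=> //; exact: closed_openC.
by apply: filterS => y /=; exact: Qf.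
Qed.

Lemma test_fun_derive f v : test_fun O f -> test_fun O ('D_v f).
Proof.
move=> [sf [Q [cQ QO Qf]]]; split.
  (* [foldr] applies the last direction of the list first, so differentiating [f] along [v]
     beforehand appends [v] at the end. *)
  by move=> s; have := sf (rcons s v); rewrite foldr_rcons.
by exists Q; split=> // x Qx; exact: derive_off_compact cQ Qf Qx.
Qed.

Lemma bounded_off_compact f (Q : set E) (c : R) : continuous f -> compact Q ->
  (forall x, ~ Q x -> `|f x| <= c) -> exists M, forall x, `|f x| <= M.
Proof.
move=> cf cQ Qf.
have /compact_bounded[M [_ HM]] : compact (f @` Q).
  by apply: continuous_compact => //; exact: continuous_subspaceT.
exists (Num.max c (M + 1)) => x; have [Qx|Qx] := pselect (Q x).
  have M1 : M < M + 1 by rewrite ltrDl.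
  by rewrite le_max; apply/orP; right; apply: HM M1 _ _; exists x.
by rewrite le_max Qf.
Qed.

Lemma compact_support_bounded f : continuous f -> compact_support f ->
  exists M, forall x, `|f x| <= M.
Proof.
move=> cf [Q [cQ _ Qf]]; apply: (bounded_off_compact (c := 0) cf cQ) => x Qx.
by rewrite Qf// normr0.
Qed.

Lemma test_fun_bounded f : test_fun O f -> exists M, forall x, `|f x| <= M.
Proof.
by move=> tf; apply: compact_support_bounded;
  [exact: test_fun_continuous|exact: test_fun_support].
Qed.

Lemma test_fun_measurable f : test_fun O f ->
  measurable_fun setT (f : E -> measurableTypeR R).
Proof. by move=> /test_fun_continuous /continuous_measurable_rV. Qed.

Lemma test_fun_grad f i : test_fun O f -> test_fun O (fun x => grad f x ord0 i).
Proof.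
move=> tf; rewrite (_ : (fun _ => _) = 'D_(delta_mx ord0 i) f); first exact: test_fun_derive.
by apply/funext => x; rewrite mxE.
Qed.

(** Second partial derivatives of a test function are again test functions, hence bounded; the sum
    of these finitely many bounds serves for all of them at once. *)
Lemma taylor_test_fun f : test_fun O f -> exists2 C, 0 <= C &
  forall x y, `|f x - f y - dotv (x - y) (grad f x)| <= C * sqnorm (x - y).
Proof.
move=> tf; pose e i : E := delta_mx ord0 i.
have /choice[M HM] : forall ij : 'I_d * 'I_d, exists M, forall x,
    `|'D_(e ij.2) ('D_(e ij.1) f) x| <= M.
  by move=> ij; apply: test_fun_bounded; do 2 apply: test_fun_derive.
pose N := \sum_ij `|M ij|.
have N0 : 0 <= N by apply: sumr_ge0.
exists (2 * N * d%:R); first by rewrite !mulr_ge0.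
apply: taylor_partials => // [i y|i j y|i j y].
- exact: test_fun_derivable.
- by apply: test_fun_derivable; exact: test_fun_derive.
- apply: le_trans (HM (i, j) y) _; apply: le_trans (ler_norm _) _.
  by rewrite /N (bigD1 (i, j))//= lerDl; apply: sumr_ge0.
Qed.

Lemma continuous_dotv (u v : E -> E) :
  (forall i, continuous (fun x => u x ord0 i)) ->
  (forall i, continuous (fun x => v x ord0 i)) ->
  continuous (fun x => dotv (u x) (v x)).
Proof.
move=> cu cv; apply: continuous_big => [|i _ x]; first exact: add_continuous.
exact: (cvgM (cu i x) (cv i x)).
Qed.

Lemma grad_support f : test_fun O f -> compact_support (fun x => sqnorm (grad f x)).
Proof.
case=> sf [Q [cQ QO Qf]]; exists Q; split=> // x Qx.
rewrite /sqnorm /dotv big1// => i _.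
by rewrite mxE (derive_off_compact _ cQ Qf Qx) mul0r.
Qed.

End test_functions.

(** * Lipschitz functions vanishing at infinity determine a measure *)

Section lipschitz_determining.
Context {R : realType} {d : nat}.
Local Notation E := 'rV[R]_d.
Local Notation fmeas := {finite_measure set E -> \bar R}.
Implicit Types (V O : set E) (x y : E).

Lemma Mplus_setI O (mu : fmeas) A : measurable O -> Mplus O mu -> measurable A ->
  mu (A `&` O) = mu A.
Proof.
move=> mO muO mA; have h : mu (A `\` O) = 0%E.
  apply: (@subset_measure0 _ _ _ mu _ (~` O)) => //.
  - exact: measurableD.
  - exact: measurableC.
by have := measureDI mu mA mO; rewrite [X in _ = (X + _)%E]h add0e => /esym.
Qed.

Let bdists V x : set R := [set r | r = 1 \/ exists2 y, ~ V y & r = `|x - y|].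

(* min(1, dist(x, V^c)), also when V^c is empty *)
Definition bdist V x : R := inf (bdists V x).

Let bdists_ge0 V x : lbound (bdists V x) 0.
Proof. by move=> r [->|[y _ ->]]. Qed.

Let bdists_lb V x : has_lbound (bdists V x).
Proof. by exists 0; exact: bdists_ge0. Qed.

Let bdists_nonempty V x : bdists V x !=set0.
Proof. by exists 1; left. Qed.

Lemma bdist_ge0 V x : 0 <= bdist V x.
Proof. by apply: lb_le_inf; [exact: bdists_nonempty|exact: bdists_ge0]. Qed.

Lemma bdist_out V x : ~ V x -> bdist V x = 0.
Proof.
move=> Vx; apply/eqP; rewrite eq_le bdist_ge0 andbT.
by apply: ge_inf; [exact: bdists_lb|right]; exists x => //; rewrite subrr normr0.
Qed.

Lemma bdist_gt0 V x : open V -> V x -> 0 < bdist V x.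
Proof.
move=> oV Vx; have /nbhs_ballP[e /= e0 xeV] : nbhs x V by exact: open_nbhs_nbhs.
apply: (@lt_le_trans _ _ (Num.min 1 e)); first by rewrite lt_min ltr01.
apply: lb_le_inf => [|r]; first exact: bdists_nonempty.
move=> [->|[y Vy ->]]; rewrite ge_min ?lexx//.
apply/orP; right; rewrite leNgt; apply/negP => xy.
by apply: Vy; apply: xeV; rewrite -ball_normE /ball_ /=.
Qed.

Lemma bdist_lipschitz V x y : `|bdist V x - bdist V y| <= `|x - y|.
Proof.
wlog suff H : x y / bdist V x - bdist V y <= `|x - y|.
  by rewrite ler_norml lerNl opprB {1}distrC !H.
rewrite lerBlDl -lerBlDr; apply: lb_le_inf => [|r]; first exact: bdists_nonempty.
move=> [->|[z Vz ->]]; rewrite lerBlDr.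
  by apply: (@le_trans _ _ 1); [apply: ge_inf; [exact: bdists_lb|left]|rewrite lerDl].
apply: (@le_trans _ _ `|x - z|); first by apply: ge_inf; [exact: bdists_lb|right]; exists z.
by rewrite [leRHS]addrC; apply: le_trans (ler_normD _ _); rewrite addrA subrK.
Qed.

(** Lipschitz approximation from below of the indicator of an open set [V], nondecreasing in [n]. *)
Definition plateau V (n : nat) x : R := Num.min 1 (n%:R * bdist V x).

Lemma plateau_lipschitz V n x y :
  `|plateau V n x - plateau V n y| <= n%:R * `|x - y|.
Proof.
wlog suff H : x y / plateau V n x - plateau V n y <= n%:R * `|x - y|.
  by rewrite ler_norml lerNl opprB {1}distrC !H.
have /(ler_wpM2l (ler0n R n)) := le_trans (ler_norm _) (bdist_lipschitz V x y).
rewrite mulrBr /plateau => h2; have h3 : 0 <= n%:R * `|x - y| by rewrite mulr_ge0.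
by rewrite !minEle; do 2 case: ifP; lra.
Qed.

Lemma plateau_ge0 V n x : 0 <= plateau V n x.
Proof. by rewrite le_min ler01 mulr_ge0 ?bdist_ge0. Qed.

Lemma lipschitz_continuous (f : E -> R) (L : R) :
  (forall x y, `|f x - f y| <= L * `|x - y|) -> continuous f.
Proof.
move=> fL x; apply/(@cvgrPdist_le _ _ _ (nbhs x)) => e e0.
(* A positive constant is needed in order to divide by it, whatever the sign of [L]. *)
have LL : L <= `|L| + 1 by rewrite ler_wpDr ?ler_norm.
have L1 : 0 < `|L| + 1 by rewrite ltr_wpDl.
near=> y; apply: le_trans (fL x y) _.
apply: (@le_trans _ _ ((`|L| + 1) * `|x - y|)); first by rewrite ler_wpM2r.
rewrite mulrC -ler_pdivlMr//; near: y.
have := @nbhsx_ballx _ E x _ (divr_gt0 e0 L1).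
by apply: filterS => y; rewrite -ball_normE /ball_ /= => /ltW.
Unshelve. all: by end_near. Qed.

(** The superlevel set of [plateau V n] at height [e > 0] is closed, lies in [V], and is bounded
    with [V], hence compact. *)
Lemma plateau_vanishes V n : bounded_set V ->
  forall e : R, 0 < e -> exists Q, [/\ compact Q, Q `<=` V &
    forall x, ~ Q x -> `|plateau V n x| < e].
Proof.
move=> bV e e0; pose Q := [set x | e <= plateau V n x].
have QV : Q `<=` V.
  move=> x; rewrite /Q/=; apply: contraPP => Vx.
  by rewrite /plateau bdist_out// mulr0 min_r//; apply/negP; rewrite -ltNge.
exists Q; split=> //; last first.
  by move=> x /negP; rewrite -ltNge ger0_norm ?plateau_ge0.
apply: bounded_closed_compact; first by move: bV => [M [Mr bM]]; exists M; split=> // r Mr' x /QV; exact: bM.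
have -> : Q = plateau V n @^-1` [set r | e <= r] by [].
apply: closed_comp => [x _|]; last exact: closed_ge.
exact: (lipschitz_continuous (@plateau_lipschitz V n)).
Qed.

(** Monotone convergence: at a point of [V] the plateau equals 1 as soon as [n] exceeds the inverse
    of [bdist], and outside [V] it is 0. *)
Let integral_plateau_cvg V O (mu : fmeas) : measurable O -> Mplus O mu -> open V ->
  (\int[mu]_(x in O) (plateau V n x)%:E @[n --> \oo] --> mu V)%E.
Proof.
move=> mO muO oV; have mV := open_measurable_rV oV.
have <- : (\int[mu]_(x in O) limn (fun n => (plateau V n x)%:E) = mu V)%E.
  rewrite -(Mplus_setI mO muO mV) -integral_indic//; apply: eq_integral => x _.
  apply/cvg_lim => //; rewrite indicE.
  have [Vx|Vx] := pselect (V x); last first.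
    rewrite memNset//; apply: cvg_near_cst; apply: nearW => n.
    by rewrite /plateau bdist_out// mulr0 min_r.
  rewrite mem_set//; apply: cvg_near_cst; near=> n.
  have b0 := bdist_gt0 oV Vx.
  rewrite /plateau min_l// -ler_pdivrMr//; near: n; exact: nbhs_infty_ger.
apply: cvg_monotone_convergence => //.
- move=> n; apply/measurable_EFinP; apply: measurable_funTS.
  by apply: continuous_measurable_rV; exact: (lipschitz_continuous (@plateau_lipschitz V n)).
- by move=> n x _; rewrite lee_fin plateau_ge0.
- move=> x _ m n mn; rewrite lee_fin /plateau le_min ge_min lexx/=.
  by rewrite ge_min; apply/orP; right; rewrite ler_wpM2r ?bdist_ge0// ler_nat.
Unshelve. all: by end_near. Qed.

Lemma Mplus_unique_lipschitz O (mu nu : fmeas) : open O -> Mplus O mu -> Mplus O nu ->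
  (forall (f : E -> R) (L : R), (forall x y, `|f x - f y| <= L * `|x - y|) ->
     (forall e : R, 0 < e -> exists Q, [/\ compact Q, Q `<=` O &
       forall x, ~ Q x -> `|f x| < e]) ->
     (\int[mu]_(x in O) (f x)%:E = \int[nu]_(x in O) (f x)%:E)%E) ->
  meas_eq mu nu.
Proof.
move=> oO muO nuO H; have mO := open_measurable_rV oO.
have HV V : open V -> bounded_set V -> V `<=` O -> mu V = nu V.
  move=> oV bV VO; have hmu := integral_plateau_cvg mO muO oV.
  have hnu := integral_plateau_cvg mO nuO oV.
  rewrite -(cvg_lim _ hmu)// -(cvg_lim _ hnu)//; congr (lim (_ @ \oo)).
  apply/funext => n; apply: H (plateau_lipschitz V n) _ => e e0.
  have [Q [cQ QV Qe]] := plateau_vanishes n bV e0.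
  by exists Q; split=> //; exact: subset_trans VO.
apply: measure_unique_open => V oV.
have mV := open_measurable_rV oV.
rewrite -(Mplus_setI mO muO mV) -(Mplus_setI mO nuO mV).
(* The plateaus are admissible tests only for bounded open subsets of [O]; a general open set, cut
   down to [O], is exhausted by such subsets. *)
pose W (n : nat) : set E := V `&` O `&` ball 0 n%:R.
have oW n : open (W n).
  apply: openI; first exact: openI.
  have [->|n0] := eqVneq (n%:R : R) 0; last by apply: ball_open; rewrite lt0r n0 ler0n.
  rewrite (_ : ball _ _ = set0); first exact: open0.
  by rewrite -ball_normE; apply/seteqP; split => // x /=; rewrite ltNge normr_ge0.
have UW : V `&` O = \bigcup_n W n.
  apply/seteqP; split => [x VOx|x [n _] []//].
  exists (Num.truncn `|x|).+1 => //; split=> //.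
  rewrite -ball_normE/= sub0r normrN; exact: truncnS_gt.
have ndW : nondecreasing_seq W.
  move=> m n mn; apply/subsetPset => x [VOx bx]; split=> //.
  by move: bx; rewrite -ball_normE/= => bx; apply: lt_le_trans bx _; rewrite ler_nat.
have mW n := open_measurable_rV (oW n).
have mUW : measurable (\bigcup_n W n) by exact: bigcupT_measurable.
have hmu := @nondecreasing_cvg_mu _ _ _ mu W mW mUW ndW.
have hnu := @nondecreasing_cvg_mu _ _ _ nu W mW mUW ndW.
rewrite UW -(cvg_lim _ hmu)// -(cvg_lim _ hnu)//; congr (lim (_ @ \oo)).
apply/funext => n /=; apply: HV => // [|x [[]//]]; rewrite /W.
have [->|n0] := eqVneq (n%:R : R) 0.
  exists 0; split=> [|r r0 x [_]]; first exact: num_real.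
  by rewrite -ball_normE/= => h; have := normr_ge0 (0 - x); rewrite leNgt h.
exists n%:R; split=> [|r r0 x [_]]; first exact: num_real.
by rewrite -ball_normE/= sub0r normrN => h; exact: ltW (lt_trans h r0).
Qed.

End lipschitz_determining.

(** * Energy dissipation along the scheme *)

Section dissipation.
Context {R : realType} {d : nat}.
Local Notation E := 'rV[R]_d.
Local Notation fmeas := {finite_measure set E -> \bar R}.
Local Open Scope ereal_scope.

Lemma sqnorm_ge0 (x : E) : (0 <= sqnorm x)%R.
Proof. by apply: sumr_ge0 => i _; rewrite -expr2 sqr_ge0. Qed.

Lemma measurable_dotv d1 (T : measurableType d1) (D : set T) (u v : T -> E) :
  (forall i, measurable_fun D (fun x => u x ord0 i : measurableTypeR R)) ->
  (forall i, measurable_fun D (fun x => v x ord0 i : measurableTypeR R)) ->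
  measurable_fun D (fun x => dotv (u x) (v x) : measurableTypeR R).
Proof. by move=> mu mv; apply: measurable_sum => i; apply: measurable_funM; [exact: mu|exact: mv]. Qed.

Lemma measurable_coord_sub (i : 'I_d) :
  measurable_fun setT (fun p : E * E => (p.1 - p.2)%R ord0 i : measurableTypeR R).
Proof.
rewrite (_ : (fun _ => _) = (fun p : E * E => p.1 ord0 i - p.2 ord0 i)%R); last first.
  by apply/funext => p; rewrite !mxE.
apply: measurable_funB.
- exact: (measurableT_comp (measurable_coord i) measurable_fst).
- exact: (measurableT_comp (measurable_coord i) measurable_snd).
Qed.

Lemma measurable_sqnorm_sub :
  measurable_fun setT (fun p : E * E => sqnorm (p.1 - p.2) : measurableTypeR R).
Proof.
have mc := @measurable_coord_sub.
exact: (@measurable_dotv _ _ setT (fun p : E * E => p.1 - p.2)%R (fun p => p.1 - p.2)%R).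
Qed.

Lemma MK2_ge0 (mu nu : fmeas) : 0 <= MK2 mu nu.
Proof.
apply: le_ereal_inf_tmp => _ [g _ <-].
by apply: integral_ge0 => p _; rewrite lee_fin sqnorm_ge0.
Qed.

(** The image of [mu] under the diagonal map is a coupling of zero cost. *)
Lemma MK2_self (mu : fmeas) : MK2 mu mu = 0.
Proof.
apply/eqP; rewrite eq_le MK2_ge0 andbT.
have mdiag : measurable_fun setT (fun x : E => (x, x)).
  exact: measurable_fun_pair.
pose diag : {mfun E >-> (E * E)%type} :=
  HB.pack (fun x : E => (x, x)) (isMeasurableFun.Build _ _ _ _ _ mdiag).
apply: ereal_inf_lbound; exists (pushforward mu diag).
  move=> A mA; rewrite /pushforward; split; congr (mu _); apply/seteqP.
    by split => [x []|x].
  by split => [x []|x].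
rewrite ge0_integral_pushforward//=.
- by rewrite integral0_eq// => x _; rewrite subrr /sqnorm /dotv big1// => i _; rewrite mxE mul0r.
- by apply/measurable_EFinP; exact: measurable_sqnorm_sub.
- by move=> p _; rewrite lee_fin sqnorm_ge0.
Unshelve. all: exact: mdiag.
Qed.

Lemma FR2_ge0 (O : set E) (mu nu : fmeas) : 0 <= FR2 O mu nu.
Proof. by apply: mule_ge0 => //; apply: integral_ge0 => x _; rewrite lee_fin sqr_ge0. Qed.

Lemma FR2_self (O : set E) (mu : fmeas) : FR2 O mu mu = 0.
Proof. by rewrite /FR2 integral0_eq ?mule0// => x _; rewrite subrr expr0n. Qed.

Variables (O : set E) (U : R -> R) (Psi K : E -> R) (m tau : R).
Hypothesis tau_gt0 : (0 < tau)%R.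
Hypothesis energy_ge : forall mu, Mplus O mu -> m%:E <= energy O U Psi K mu.
Variables (rho0 : fmeas) (rho rhoh : nat -> fmeas).
Hypothesis scheme : splitting_scheme O U Psi K tau rho0 rho rhoh.
Hypothesis rho0_energy : energy O U Psi K rho0 < +oo.
Local Notation F := (energy O U Psi K).

Let itau_ge0 : 0 <= ((2 * tau)^-1)%:E.
Proof. by rewrite lee_fin invr_ge0 mulr_ge0// ltW. Qed.

(** The previous iterate [rho n] is an admissible competitor with zero transport cost. *)
Lemma scheme_step_MK n : ((2 * tau)^-1)%:E * MK2 (rhoh n) (rho n) + F (rhoh n) <= F (rho n).
Proof.
have [_ /(_ n)[M2n [_ min] _ _ _]] := scheme.
by have := min (rho n) (conj M2n erefl); rewrite MK2_self mule0 add0e.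
Qed.

Lemma scheme_Mplus n : Mplus O (rho n).
Proof. by have [_ /(_ n)[[]]] := scheme. Qed.

Lemma scheme_Mplus_half n : Mplus O (rhoh n).
Proof. by have [_ /(_ n)[_ [[[]]]]] := scheme. Qed.

Lemma scheme_mass_half n : rhoh n setT = rho n setT.
Proof. by have [_ /(_ n)[_ [[]]]] := scheme. Qed.

(** The competitor is [rhoh n]; the nonnegative Fisher-Rao term of the minimizer is then dropped. *)
Lemma scheme_step_FR n : F (rho n.+1) <= F (rhoh n).
Proof.
have [_ /(_ n)[_ _ _ [_ min] _]] := scheme.
have := min (rhoh n) (scheme_Mplus_half n); rewrite FR2_self mule0 add0e.
apply: le_trans; rewrite leeDr// mule_ge0 ?FR2_ge0//.
Qed.

(** The two energy inequalities of each step are chained by induction, and the last energy is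
    bounded below by [m]. *)
Lemma scheme_dissipation N :
  \sum_(n < N) MK2 (rhoh n) (rho n) <= (2 * tau * (fine (F rho0) - m))%:E.
Proof.
have S_ge0 N' : 0 <= \sum_(n < N') MK2 (rhoh n) (rho n).
  by apply: sume_ge0 => n _; exact: MK2_ge0.
have H : ((2 * tau)^-1)%:E * \sum_(n < N) MK2 (rhoh n) (rho n) + F (rho N) <= F rho0.
  elim: N => [|N IH]; first by rewrite big_ord0 mule0 add0e; have [-> _] := scheme.
  rewrite big_ord_recr/= ge0_muleDr; [|exact: S_ge0|exact: MK2_ge0].
  pose a := ((2 * tau)^-1)%:E * \sum_(n < N) MK2 (rhoh n) (rho n).
  pose b := ((2 * tau)^-1)%:E * MK2 (rhoh N) (rho N).
  have step : b + F (rho N.+1) <= F (rho N).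
    by apply: le_trans (scheme_step_MK N); exact/leeD2l/scheme_step_FR.
  suff : a + (b + F (rho N.+1)) <= F rho0 by rewrite addeA.
  by apply: le_trans IH; exact: leeD2l.
have c0 : 0 <= ((2 * tau)^-1)%:E * \sum_(n < N) MK2 (rhoh n) (rho n).
  by rewrite mule_ge0.
(* The initial energy lies between [m] and [+oo], hence is finite and [fine] keeps its value. *)
have m0 : m%:E <= F rho0 by have [<- _] := scheme; exact/energy_ge/scheme_Mplus.
have F0 : F rho0 \is a fin_num.
  by rewrite fin_numElt rho0_energy andbT (lt_le_trans _ m0)// ltNyr.
have mN : m%:E <= F (rho N) by exact/energy_ge/scheme_Mplus.
have {}H : ((2 * tau)^-1)%:E * \sum_(n < N) MK2 (rhoh n) (rho n) <= F rho0 - m%:E.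
  by rewrite leeBrDr; [apply: le_trans H; exact: leeD2l|].
rewrite -lee_pdivlMl// in H; last by rewrite invr_gt0 mulr_gt0.
by rewrite invrK in H; rewrite EFinM EFinB fineK.
Qed.

End dissipation.

(** * Integral estimates along an optimal map *)

Section optimal_transport_estimates.
Context {R : realType} {d : nat}.
Local Notation E := 'rV[R]_d.
Local Notation fmeas := {finite_measure set E -> \bar R}.

Lemma young_real (a b e : R) : 0 < e -> `|a * b| <= e * b ^+ 2 + e^-1 * a ^+ 2.
Proof.
move=> e0; rewrite normrM -(real_normK (num_real a)) -(real_normK (num_real b)).
have := normr_ge0 a; have := normr_ge0 b; move: `|a| `|b| => {a b} a b b0 a0.
rewrite -(ler_pM2l e0) mulrDr !mulrA divff ?gt_eqF// mul1r.
by have := sqr_ge0 (e * b - a); nra.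
Qed.

Lemma young_dotv (x y : E) (e : R) : 0 < e ->
  `|dotv x y| <= e * sqnorm y + e^-1 * sqnorm x.
Proof.
move=> e0; apply: le_trans (ler_norm_sum _ _ _) _.
rewrite /sqnorm /dotv !mulr_sumr -big_split/=; apply: ler_sum => i _.
by rewrite -!expr2; exact: young_real.
Qed.

(** Young's inequality against the constant 1. It trades a displacement for a squared displacement,
    which the transport cost controls; [e] is left free for scaling with [tau]. *)
Lemma norm_le_sqnorm (v : E) (e : R) : 0 < e -> `|v| <= e + e^-1 * sqnorm v.
Proof.
move=> e0; have c0 : 0 <= e + e^-1 * sqnorm v.
  by rewrite addr_ge0 ?(ltW e0)// mulr_ge0 ?sqnorm_ge0// invr_ge0 ltW.
rewrite [leLHS]mx_normrE; apply: bigmax_le => // -[i j] _ /=; rewrite (ord1 i).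
have := young_real (v ord0 j) 1 e0; rewrite !mulr1 expr1n mulr1 => h.
apply: le_trans h _; rewrite lerD2l ler_wpM2l ?invr_ge0 ?(ltW e0)//.
rewrite /sqnorm /dotv (bigD1 j)//= expr2 lerDl.
by apply: sumr_ge0 => k _; rewrite -expr2 sqr_ge0.
Qed.

Lemma bounded_integrable (mu : fmeas) (D : set E) (f : E -> R) : measurable D ->
  measurable_fun setT (f : E -> measurableTypeR R) -> (exists M, forall x, `|f x| <= M) ->
  mu.-integrable D (EFin \o f).
Proof.
move=> mD mf [M fM]; apply: measurable_bounded_integrable => //.
- by rewrite ltey_eq fin_num_measure.
- exact: measurable_funTS.
- exists M; split; first exact: num_real.
  by move=> N MN x _; exact: le_trans (fM x) (ltW MN).
Qed.

Lemma ler_norm_Rintegral d1 (T : measurableType d1) (mu : {measure set T -> \bar R})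
    (D : set T) (g h : T -> R) : measurable D ->
  measurable_fun D g -> mu.-integrable D (EFin \o h) ->
  (forall x, D x -> `|g x| <= h x) ->
  `|\int[mu]_(x in D) g x| <= \int[mu]_(x in D) h x.
Proof.
move=> mD mg ih gh.
have ig : mu.-integrable D (EFin \o g).
  apply: le_integrable ih => //; first exact/measurable_EFinP.
  by move=> x Dx; rewrite lee_fin; apply: le_trans (gh x Dx) (ler_norm _).
apply: le_trans (le_normr_Rintegral mD ig) _.
by apply: le_Rintegral => //; exact: integrable_norm.
Qed.

Lemma integrableD_EFin d1 (T : measurableType d1) (mu : {measure set T -> \bar R})
    (D : set T) (g h : T -> R) : measurable D ->
  mu.-integrable D (EFin \o g) -> mu.-integrable D (EFin \o h) ->
  mu.-integrable D (EFin \o (fun x => g x + h x)).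
Proof. by move=> mD ig ih; exact: (integrableD mD ig ih). Qed.

Lemma integral_Mplus (O : set E) (mu : fmeas) (f : E -> \bar R) : measurable O -> Mplus O mu ->
  mu.-integrable setT f -> (\int[mu]_(x in O) f x = \int[mu]_x f x)%E.
Proof.
move=> mO muO fi; rewrite [RHS](negligible_integral (measurableC mO))//.
by rewrite setTD setCK.
Qed.

Lemma Rintegral_Mplus (O : set E) (mu : fmeas) (f : E -> R) : measurable O -> Mplus O mu ->
  mu.-integrable setT (EFin \o f) -> \int[mu]_(x in O) f x = \int[mu]_x f x.
Proof. by move=> mO muO fi; congr fine; exact: integral_Mplus. Qed.

Variables (O : set E) (mu nu : fmeas) (T : E -> E).
Hypotheses (mO : measurable O) (muO : Mplus O mu) (nuO : Mplus O nu).
Hypothesis optT : optimal_map T mu nu.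
Hypothesis cost_fin : (MK2 mu nu < +oo)%E.

Let cost : R := fine (MK2 mu nu).

Let mT : measurable_fun setT T.
Proof. by case: optT. Qed.

Let measurable_subT i : measurable_fun setT (fun x : E => (x - T x) ord0 i : measurableTypeR R).
Proof.
rewrite (_ : (fun _ => _) = (fun x : E => x ord0 i - T x ord0 i)); last first.
  by apply/funext => p; rewrite !mxE.
apply: measurable_funB; first exact: measurable_coord.
exact: (measurableT_comp (measurable_coord i) mT).
Qed.

Lemma measurable_cost : measurable_fun setT (fun x : E => sqnorm (x - T x) : measurableTypeR R).
Proof. exact: (@measurable_dotv _ _ _ _ setT (fun x : E => x - T x) (fun x : E => x - T x)). Qed.

Lemma integrable_cost : mu.-integrable setT (fun x : E => (sqnorm (x - T x))%:E).
Proof.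
apply/integrableP; split; first by apply/measurable_EFinP; exact: measurable_cost.
under eq_integral do rewrite gee0_abs ?lee_fin ?sqnorm_ge0//.
by case: optT => _ _ ->.
Qed.

Lemma Rintegral_cost : \int[mu]_x sqnorm (x - T x) = cost.
Proof. by rewrite /Rintegral; case: optT => _ _ ->. Qed.

Lemma Rintegral_optimal_map (f : E -> R) :
  measurable_fun setT (f : E -> measurableTypeR R) -> (exists M, forall x, `|f x| <= M) ->
  \int[nu]_x f x = \int[mu]_x f (T x).
Proof.
move=> mf [M fM]; pose phi : {mfun E >-> E} :=
  HB.pack T (isMeasurableFun.Build _ _ _ _ _ mT).
have fT : mu.-integrable setT (EFin \o (f \o T)).
  apply: bounded_integrable => //; last by exists M => x; exact: fM.
  exact: measurableT_comp mf mT.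
rewrite /Rintegral; congr fine.
rewrite (@eq_measure_integral _ _ _ _ (pushforward mu phi)); last first.
  by move=> A mA _; have [_ /(_ A mA) h _] := optT; exact: esym h.
by rewrite integral_pushforward//; exact/measurable_EFinP.
Unshelve. all: exact: mT.
Qed.

Lemma Rintegral_diff_optimal (f : E -> R) :
  measurable_fun setT (f : E -> measurableTypeR R) -> (exists M, forall x, `|f x| <= M) ->
  \int[mu]_(x in O) f x - \int[nu]_(x in O) f x = \int[mu]_x (f x - f (T x)).
Proof.
move=> mf bf; have ibf (m : fmeas) := bounded_integrable m measurableT mf bf.
rewrite (Rintegral_Mplus mO muO (ibf mu)) (Rintegral_Mplus mO nuO (ibf nu)).
rewrite Rintegral_optimal_map// RintegralB//; first exact: ibf.
case: bf => M fM; apply: bounded_integrable => //; last by exists M => x; exact: fM.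
exact: measurableT_comp mf mT.
Qed.

(** Pulled back by [T], the difference is the integral of [f x - f (T x)]; [norm_le_sqnorm] then
    bounds the displacement by [e] plus its square over [e]. *)
Lemma lipschitz_optimal (f : E -> R) (L e : R) : 0 <= L -> 0 < e ->
  (exists M, forall x, `|f x| <= M) ->
  (forall x y, `|f x - f y| <= L * `|x - y|) ->
  `|\int[mu]_(x in O) f x - \int[nu]_(x in O) f x| <=
     L * (e * fine (mu setT) + e^-1 * cost).
Proof.
move=> L0 e0 bf Lf.
have mf : measurable_fun setT (f : E -> measurableTypeR R).
  by apply: continuous_measurable_rV; exact: lipschitz_continuous Lf.
rewrite Rintegral_diff_optimal//.
have -> : L * (e * fine (mu setT) + e^-1 * cost) =
    \int[mu]_x (L * e + L * e^-1 * sqnorm (x - T x)).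
  rewrite RintegralD//.
  - rewrite Rintegral_cst// RintegralZl//; last exact: integrable_cost.
    by rewrite Rintegral_cost; ring.
  - exact: finite_measure_integrable_cst.
  - exact: (integrableZl _ _ integrable_cost).
apply: ler_norm_Rintegral => //.
- apply: measurable_funB => //; exact: measurableT_comp mf mT.
- apply: integrableD_EFin => //; first exact: finite_measure_integrable_cst.
  exact: (integrableZl _ _ integrable_cost).
move=> x _; apply: le_trans (Lf _ _) _; rewrite -mulrA -mulrDr ler_wpM2l//.
exact: norm_le_sqnorm.
Qed.

Let measurable_grad phi (i : 'I_d) : test_fun O phi ->
  measurable_fun setT (fun x => grad phi x ord0 i : measurableTypeR R).
Proof. by move=> tphi; apply: test_fun_measurable; exact: test_fun_grad tphi. Qed.

Lemma integrable_sqnorm_grad (m : fmeas) (phi : E -> R) : test_fun O phi ->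
  m.-integrable setT (EFin \o (fun x => sqnorm (grad phi x))).
Proof.
move=> tphi; have cg : continuous (fun x => sqnorm (grad phi x)).
  by apply: continuous_dotv => i; apply: test_fun_continuous; exact: test_fun_grad tphi.
apply: bounded_integrable => //; first exact: continuous_measurable_rV.
by apply: compact_support_bounded => //; exact: grad_support tphi.
Qed.

Lemma measurable_displacement (phi : E -> R) : test_fun O phi ->
  measurable_fun setT (fun x : E => dotv (x - T x) (grad phi x) : measurableTypeR R).
Proof.
move=> tphi; apply: (@measurable_dotv _ _ _ _ setT (fun x : E => x - T x) (grad phi)) => // i.
exact: measurable_grad.
Qed.

Let integrable_young (phi : E -> R) (e : R) : test_fun O phi ->
  mu.-integrable setT (EFin \o (fun x : E => e * sqnorm (grad phi x) + e^-1 * sqnorm (x - T x))).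
Proof.
move=> tphi; apply: integrableD_EFin => //.
  exact: (integrableZl _ _ (integrable_sqnorm_grad mu tphi)).
exact: (integrableZl _ _ integrable_cost).
Qed.

Lemma integrable_displacement (phi : E -> R) : test_fun O phi ->
  mu.-integrable setT (EFin \o (fun x : E => dotv (x - T x) (grad phi x))).
Proof.
move=> tphi; apply: le_integrable (integrable_young 1 tphi) => //.
  by apply/measurable_EFinP; exact: measurable_displacement.
move=> x _; rewrite lee_fin; apply: le_trans (ler_norm _).
exact: young_dotv.
Qed.

(** The Taylor bound at [x] and [T x] is integrated against [mu]; the quadratic remainder integrates
    to the transport cost. *)
Lemma taylor_optimal (phi : E -> R) (C : R) : test_fun O phi ->
  (forall x y, `|phi x - phi y - dotv (x - y) (grad phi x)| <= C * sqnorm (x - y)) ->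
  `|\int[mu]_(x in O) phi x - \int[nu]_(x in O) phi x
     - \int[mu]_(x in O) dotv (x - T x) (grad phi x)| <= C * cost.
Proof.
move=> tphi hC; have mphi := test_fun_measurable tphi.
have bphi := test_fun_bounded tphi.
have mphiT : measurable_fun setT (fun x => phi (T x) : measurableTypeR R).
  exact: measurableT_comp mphi mT.
have iphi : mu.-integrable setT (EFin \o (fun x => phi x - phi (T x))).
  case: bphi => M phiM; apply: bounded_integrable => //.
    exact: measurable_funB.
  by exists (M + M) => x; apply: le_trans (ler_normB _ _) _; exact: lerD.
have idisp := integrable_displacement tphi.
rewrite Rintegral_diff_optimal// (Rintegral_Mplus mO muO idisp) -RintegralB//.
rewrite -Rintegral_cost -RintegralZl//; last exact: integrable_cost.
apply: ler_norm_Rintegral => //.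
- apply: measurable_funB; first exact: measurable_funB.
  exact: measurable_displacement.
- exact: (integrableZl _ _ integrable_cost).
Qed.

(** A cruder bound than the Taylor one, meant for single incomplete steps, where no telescoping is
    available. *)
Lemma young_optimal (phi : E -> R) (e : R) : test_fun O phi -> 0 < e ->
  `|\int[mu]_(x in O) dotv (x - T x) (grad phi x)| <=
  e * \int[mu]_(x in O) sqnorm (grad phi x) + e^-1 * cost.
Proof.
move=> tphi e0; have igrad := integrable_sqnorm_grad mu tphi.
rewrite (Rintegral_Mplus mO muO (integrable_displacement tphi)).
rewrite (Rintegral_Mplus mO muO igrad) -Rintegral_cost.
rewrite -(RintegralZl _ measurableT igrad) -(RintegralZl _ measurableT integrable_cost).
rewrite -RintegralD//; first last.
- exact: (integrableZl _ _ integrable_cost).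
- exact: (integrableZl _ _ (integrable_sqnorm_grad mu tphi)).
apply: ler_norm_Rintegral => //; last by move=> x _; exact: young_dotv.
  exact: measurable_displacement.
exact: integrable_young.
Qed.

End optimal_transport_estimates.

(** * The Euler-Lagrange equations in terms of densities *)

Section euler_lagrange_real.
Context {R : realType} {d : nat}.
Local Notation E := 'rV[R]_d.
Local Notation fmeas := {finite_measure set E -> \bar R}.
Local Notation leb := (@lebesgue_rV R d).
Local Open Scope ereal_scope.

Lemma measurable_fun_support d1 (T : measurableType d1) (Q D : set T) (f : T -> R) :
  measurable Q -> measurable D -> (forall x, ~ Q x -> f x = 0%R) ->
  measurable_fun Q f -> measurable_fun D f.
Proof.
move=> mQ mD f0 /(measurable_restrictT _ mQ) mf; apply: measurable_funTS.
rewrite (_ : f = f \_ Q)//; apply/funext => x; rewrite patchE.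
by case: ifPn => // /negP xQ; apply: f0 => Qx; apply: xQ; rewrite inE.
Qed.

(** An integral is the difference of those of the positive and negative parts, and oo - oo is
    infinite by convention, so a finite value forces both parts to be finite. *)
Lemma fin_num_integral_integrable d1 (T : measurableType d1) (mu : {measure set T -> \bar R})
    (D : set T) (f : T -> \bar R) : measurable D -> measurable_fun D f ->
  \int[mu]_(x in D) f x \is a fin_num -> mu.-integrable D f.
Proof.
move=> mD mf If; apply/integrableP; split=> //.
by apply/abse_integralP => //; rewrite -fin_num_abs.
Qed.

Lemma measurable_dens (mu : fmeas) : mu `<< leb ->
  measurable_fun setT (dens mu : E -> measurableTypeR R).
Proof.
move=> ac; have /measurable_int := Radon_Nikodym_integrable (ac : charge_of_finite_measure mu `<< leb).
by move=> mf; exact: (measurableT_comp (fine_measurable measurableT) mf).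
Qed.

Lemma integral_dens (mu : fmeas) (D : set E) (f : E -> R) : mu `<< leb -> measurable D ->
  mu.-integrable D (EFin \o f) ->
  \int[leb]_(x in D) (dens mu x * f x)%:E = \int[mu]_(x in D) (f x)%:E.
Proof.
move=> muleb mD fi; rewrite -(Radon_Nikodym_change_of_variables muleb mD fi).
apply: eq_integral => x _; rewrite /dens /= muleC -[X in _ = X * _]fineK; last first.
  exact: Radon_Nikodym_fin_num.
by rewrite EFinM.
Qed.

Variables (O : set E) (U : R -> R) (Psi K : E -> R) (tau : R).
Hypotheses (oO : open O) (tau_gt0 : (0 < tau)%R).
Variable phi : E -> R.
Hypothesis tphi : test_fun O phi.
Let mO := open_measurable_rV oO.

Lemma test_fun_supported_in : exists Q, [/\ compact Q, Q `<=` O,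
  forall x, ~ Q x -> phi x = 0%R & forall x, ~ Q x -> forall i, grad phi x ord0 i = 0%R].
Proof.
case: tphi => _ [Q [cQ QO Q0]]; exists Q; split=> // x Qx i.
by rewrite mxE (derive_off_compact _ cQ Q0 Qx).
Qed.

(** The equation is tested with [zeta = grad phi]. Its displacement term is finite, so the equation
    forces the term in [G] to be finite as well; this gives the integrability required for passing
    from [mu] to its density. *)
Lemma euler_lagrange_MK_real (mu nu : fmeas) (G : E -> E) (T : E -> E) :
  Mplus O mu -> mu `<< leb -> MK2 mu nu < +oo ->
  weak_grad O (potential O U Psi K (dens mu)) G ->
  optimal_map T mu nu ->
  (forall zeta : E -> E, (forall i, test_fun O (fun x => zeta x ord0 i)) ->
      \int[mu]_(x in O) (dotv (tau^-1 *: (x - T x)) (zeta x))%:E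
      + \int[mu]_(x in O) (dotv (G x) (zeta x))%:E = 0) ->
  \int[leb]_(x in O) (dens mu x * dotv (G x) (grad phi x))%:E =
  (- (tau^-1 * \int[mu]_(x in O) dotv (x - T x) (grad phi x)))%:E.
Proof.
move=> muO muleb cost_fin [_ locG _] optT /(_ (grad phi)) EL.
have {}EL := EL (fun i => test_fun_grad i tphi).
have idisp : mu.-integrable O (EFin \o (fun x : E => dotv (x - T x) (grad phi x))).
  by apply: (integrableS measurableT) => //; exact: (integrable_displacement optT cost_fin tphi).
have disp : \int[mu]_(x in O) (dotv (tau^-1 *: (x - T x)) (grad phi x))%:E =
    (tau^-1 * \int[mu]_(x in O) dotv (x - T x) (grad phi x))%:E.
  rewrite EFinM /Rintegral fineK; last exact: integrable_fin_num.
  rewrite -integralZl//; apply: eq_integral => x _; rewrite -EFinM; congr EFin.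
  by rewrite /dotv mulr_sumr; apply: eq_bigr => i _; rewrite !mxE mulrA.
have EG : \int[mu]_(x in O) (dotv (G x) (grad phi x))%:E =
    (- (tau^-1 * \int[mu]_(x in O) dotv (x - T x) (grad phi x)))%:E.
  move: EL; rewrite disp; case: (\int[mu]_(x in O) _) => [r| |]//=.
  by rewrite -EFinD => -[h]; congr EFin; lra.
rewrite integral_dens//; apply: fin_num_integral_integrable; rewrite ?EG//.
apply/measurable_EFinP.
have [Q [cQ QO _ Q0]] := test_fun_supported_in.
have mQ := compact_measurable_rV cQ.
(* [G] is known to be measurable on compact subsets of [O] only, which is enough because [grad phi]
   vanishes off [Q]. *)
apply: (measurable_fun_support mQ mO).
  by move=> x Qx; rewrite /dotv big1// => i _; rewrite Q0// mulr0.
apply: measurable_dotv => i.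
  by apply/measurable_EFinP; exact: measurable_int (locG i Q cQ QO).
by apply: measurable_funTS; apply: test_fun_measurable; exact: test_fun_grad tphi.
Qed.

(** The equation is solved for the reaction integral; in particular that integral is finite. *)
Lemma euler_lagrange_FR_real (rhoh rho1 : fmeas) :
  rhoh `<< leb -> rho1 `<< leb ->
  euler_lagrange_FR O U Psi K tau rhoh rho1 ->
  \int[leb]_(x in O) (reaction O U Psi K (dens rho1) (dens rhoh) x * (phi x)%:E) =
  (- (tau^-1 * (\int[rho1]_(x in O) phi x - \int[rhoh]_(x in O) phi x)))%:E.
Proof.
move=> hac ac1 /(_ phi tphi) EL.
have iphi (mu : fmeas) : mu.-integrable O (EFin \o phi).
  by apply: bounded_integrable => //; [exact: test_fun_measurable tphi|exact: test_fun_bounded tphi].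
have idens (mu : fmeas) : mu `<< leb -> leb.-integrable O (EFin \o (fun x => dens mu x * phi x)%R).
  move=> ac; apply: fin_num_integral_integrable => //; last first.
    by rewrite [X in X \is a _](integral_dens ac mO (iphi mu)); exact: integrable_fin_num (iphi mu).
  apply/measurable_EFinP; apply: measurable_funM.
    by apply: measurable_funTS; exact: measurable_dens.
  by apply: measurable_funTS; exact: test_fun_measurable tphi.
have L : \int[leb]_(x in O) ((dens rho1 x - dens rhoh x) * phi x)%:E =
   (\int[rho1]_(x in O) phi x - \int[rhoh]_(x in O) phi x)%:E.
  rewrite EFinB /Rintegral !fineK; try exact: integrable_fin_num (iphi _).
  rewrite -(integral_dens hac mO (iphi _)) -(integral_dens ac1 mO (iphi _)).
  rewrite -integralB_EFin//; try exact: idens.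
  by apply: eq_integral => x _; rewrite mulrBl.
move: EL; rewrite L; set X := \int[leb]_(x in O) _ => EL.
have -> : X = (tau^-1)%:E * (tau%:E * X).
  by rewrite muleA -EFinM mulVf ?gt_eqF// mul1e.
have -> : tau%:E * X = - (\int[rho1]_(x in O) phi x - \int[rhoh]_(x in O) phi x)%:E.
  by rewrite EL oppeK.
by rewrite -EFinN -EFinM mulrN.
Qed.

End euler_lagrange_real.

(** * Fubini on a rectangle *)

Section rectangle.
Local Open Scope ereal_scope.
Context d1 d2 (T1 : measurableType d1) (T2 : measurableType d2) (R : realType).
Variables (m1 : {sigma_finite_measure set T1 -> \bar R})
          (m2 : {sigma_finite_measure set T2 -> \bar R}).

(** Fubini's theorem on the whole product, applied to the extension of [f] by zero. *)
Lemma integral_rectangle (A : set T1) (B : set T2) (f : T1 * T2 -> \bar R) :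
  measurable A -> measurable B -> (m1 \x m2).-integrable (A `*` B) f ->
  \int[m1 \x m2]_(p in A `*` B) f p = \int[m1]_(t in A) \int[m2]_(x in B) f (t, x).
Proof.
move=> mA mB fi; have mAB : measurable (A `*` B) by exact: measurableX.
have fi' := (integrable_mkcond f mAB).1 fi.
rewrite integral_mkcond -(integral12_prod_meas1 fi').
rewrite [RHS]integral_mkcond; apply: eq_integral => t _; rewrite /fubini_F !patchE.
case: ifPn => tA.
  rewrite [RHS]integral_mkcond; apply: eq_integral => x _; rewrite !patchE.
  have [Bx|Bx] := pselect (B x).
    by rewrite !mem_set//; split=> //; exact/set_mem.
  by rewrite !memNset// => -[].
apply: integral0_eq => x _; rewrite patchE memNset// => -[/= At _].
by move/negP : tA; apply; rewrite inE.
Qed.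

End rectangle.

(** * Time integrals of step functions *)

Section step_functions.
Context {R : realType}.
Variable tau : R.
Hypothesis tau_gt0 : 0 < tau.

(* [interpolate tau s t] is [s (step_index tau t)] by conversion *)
Definition step_index (t : R) : nat := `|Num.ceil (t / tau)|%N.

Lemma step_index_ge (t : R) : 0 <= t -> t <= (step_index t)%:R * tau.
Proof.
move=> t0; rewrite -ler_pdivrMr// /step_index -[X in _ <= X]/((`|Num.ceil (t / tau)|%N : int)%:~R).
rewrite gez0_abs ?ceil_ge//.
by rewrite ceil_ge0 (lt_le_trans _ (divr_ge0 t0 (ltW tau_gt0)))// ltrN10.
Qed.

Lemma step_index_eq (t : R) n : (n%:R - 1) * tau < t -> t <= n%:R * tau ->
  step_index t = n.
Proof.
move=> h1 h2; rewrite /step_index (@ceil_def _ _ (n : int)) ?absz_nat//.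
by rewrite intrD /= ltr_pdivlMr// ler_pdivrMr// h1 h2.
Qed.

Lemma step_index_lt (t : R) : 0 <= t -> ((step_index t)%:R - 1) * tau < t \/ step_index t = 0%N.
Proof.
move=> t0; have [->|n0] := eqVneq (step_index t) 0%N; [by right|left].
rewrite -ltr_pdivlMr//; apply: le_lt_trans (ceilB1_lt _); rewrite intrD lerD2r.
rewrite /step_index -[X in X <= _]/((`|Num.ceil (t / tau)|%N : int)%:~R) gez0_abs//.
by rewrite ceil_ge0 (lt_le_trans _ (divr_ge0 t0 (ltW tau_gt0)))// ltrN10.
Qed.

Lemma step_index0 (t : R) : 0 <= t -> step_index t = 0%N -> t = 0.
Proof.
move=> t0 n0; have := step_index_ge t0; rewrite n0 mul0r => t0'.
by apply/eqP; rewrite eq_le t0 t0'.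
Qed.

Lemma step_index_theta (t : R) : 0 <= t -> `|(step_index t)%:R * tau - t| <= tau.
Proof.
move=> t0; have h1 := step_index_ge t0; rewrite ger0_norm ?subr_ge0//.
have [h|h] := step_index_lt t0; first by rewrite mulrBl mul1r in h; lra.
rewrite h mul0r sub0r; apply: (@le_trans _ _ 0); [by rewrite oppr_le0|exact: ltW].
Qed.

Variable h : nat -> R.

(** A primitive of the step function: all steps up to the current one, minus the part of that step
    lying after [t]. Its value at 0 is [tau * h 0], a constant that cancels in differences. *)
Definition step_primitive (t : R) : R :=
  tau * (\sum_(n < (step_index t).+1) h n)
  - ((step_index t)%:R * tau - t) * h (step_index t).

(** Induction on the step index of [b], cutting []a, b]] at the grid point that opens the last
    step. *)
Lemma integral_step (a b : R) : 0 <= a -> a <= b ->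
  measurable_fun `]a, b] (fun t => h (step_index t)) /\
  (\int[lebesgue_measure]_(t in `]a, b]) (h (step_index t))%:E =
   (step_primitive b - step_primitive a)%:E)%E.
Proof.
have const (c e : R) n : (n%:R - 1) * tau <= c -> c <= e -> e <= n%:R * tau ->
    measurable_fun `]c, e] (fun t => h (step_index t)) /\
    (\int[lebesgue_measure]_(t in `]c, e]) (h (step_index t))%:E = ((e - c) * h n)%:E)%E.
  move=> nc ce en.
  have eqh : {in `]c, e]%classic, (fun=> h n) =1 (fun t => h (step_index t))}.
    move=> t; rewrite inE /= in_itv/= => /andP[ct te].
    by rewrite (@step_index_eq t n)//; [exact: le_lt_trans ct|exact: le_trans en].
  split; first by apply: eq_measurable_fun eqh _; exact: measurable_cst.
  under eq_integral => t tce do rewrite -eqh//.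
  rewrite integral_cst//= lebesgue_measure_itv/= lte_fin.
  case: ltP => [ce'|ec]; first by rewrite -EFinD -EFinM mulrC.
  by rewrite mule0; have -> : e = c by [apply/eqP; rewrite eq_le ec ce]; rewrite subrr mul0r.
move=> a0; move: {2}(step_index b) (erefl (step_index b)) => m; elim: m b => [|m IH] b Nb ab.
  have b0 : b = 0 by apply: step_index0 => //; exact: le_trans ab.
  have a0' : a = 0 by apply/eqP; rewrite eq_le a0 -b0 ab.
  rewrite b0 a0' subrr set_itv_ge ?bnd_simp ?ltxx//; split; first exact: measurable_fun_set0.
  by rewrite integral_set0.
have b0 : 0 <= b by exact: le_trans ab.
have hb := step_index_ge b0; rewrite Nb in hb.
have hb' : m%:R * tau < b.
  by have [] := step_index_lt b0; rewrite Nb// -natr1 addrK.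
have [ma|am] := leP (m%:R * tau) a.
  have [|mh ->] := const a b m.+1 _ ab hb; first by rewrite -natr1 addrK.
  split=> //; congr EFin.
  (* Steps are closed on the right: if [a] is the grid point [m tau] itself, its index is [m]
     although []a, b]] lies in step [m.+1]. *)
  rewrite /step_primitive Nb; have [Na|Na] : step_index a = m.+1 \/ (m%:R * tau = a).
  - have [->|ma'] := eqVneq (m%:R * tau) a; [by right|left].
    by apply: step_index_eq; [rewrite -natr1 addrK lt_neqAle ma' ma|exact: le_trans hb].
  - by rewrite Na; ring.
  have -> : step_index a = m.
    apply: step_index_eq; last by rewrite Na.
    by rewrite -Na mulrBl mul1r ltrBlDr ltrDl.
  by rewrite big_ord_recr/= -Na -natr1; ring.
pose c := m%:R * tau.
have Nc : step_index c = m.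
  by apply: step_index_eq; rewrite /c// mulrBl mul1r ltrBlDr ltrDl.
have [mh1 Ih1] := IH c Nc (ltW am).
have [|mh2 Ih2] := const c b m.+1 _ (ltW hb') hb; first by rewrite -natr1 addrK.
have U : `]a, b]%classic = `]a, c] `|` `]c, b].
  have hcb : c <= b by exact: ltW.
  apply/seteqP; split => t /=; rewrite !in_itv/=.
    by move=> /andP[-> tb]; have [tc|ct] := leP t c; [left|right].
  by case=> /andP[h1 h2]; rewrite ?h1 ?h2 ?(lt_trans am h1) ?(le_trans h2 hcb).
have mh : measurable_fun `]a, b] (fun t => h (step_index t)).
  by rewrite U; apply/measurable_funU.
split=> //; rewrite U integral_setU//; last 2 first.
- by rewrite -U; apply/measurable_EFinP.
- apply/disj_setPS => t [] /=; rewrite !in_itv/= => /andP[_ tc] /andP[ct _].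
  by have := lt_le_trans ct tc; rewrite ltxx.
rewrite Ih1 Ih2 -EFinD; congr EFin.
rewrite /step_primitive Nb Nc [\sum_(n < m.+2) h n]big_ord_recr/= -[m.+1%:R]natr1 /c; ring.
Qed.

End step_functions.

(** * Weak local convergence tested on a time slab *)

Section spacetime_test.
Context {R : realType} {d : nat}.
Local Notation E := 'rV[R]_d.
Local Notation leb := (@lebesgue_rV R d).
Local Notation P := (@lebesgue_measure R \x leb)%E.
Local Notation spt := (measurableTypeR R * E)%type.
Variables (O : set E) (t1 t2 : R).
Hypotheses (oO : open O) (t1_gt0 : 0 < t1).
Let A : set (measurableTypeR R) := `]t1, t2[%classic.
Let AO : set spt := A `*` O.

Lemma measurable_itvX : measurable AO.
Proof. by apply: measurableX; [exact: measurable_itv|exact: open_measurable_rV]. Qed.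

Section scalar.
Variable psi : E -> R.
Hypotheses (cpsi : continuous psi) (spsi : compact_support O psi).

(** Weak L^1_loc convergence involves a compact set and a bounded weight. Here the compact set is
    [[t1, t2]] times the support of [psi], inside the open space-time because [t1 > 0], and the
    weight is the indicator of []t1, t2[] times [psi]. *)
Lemma L1loc_test_patch :
  exists Q : set (R * E), exists g : spt -> R,
  [/\ compact Q, Q `<=` spacetime O, measurable_fun setT g,
      exists M, forall p, `|g p| <= M &
      measurable (Q : set spt) /\
      forall f : spt -> \bar R,
      ((fun p => f p * (g p)%:E) \_ Q = (fun p => f p * (psi p.2)%:E) \_ AO)%E].
Proof.
case: (spsi) => S [cS SO S0].
exists (`[t1, t2]%classic `*` S), (fun p : spt => \1_A p.1 * psi p.2).
have [M psiM] := compact_support_bounded cpsi spsi.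
split.
- by apply: compact_setX => //; exact: segment_compact.
- move=> [t x] [/=]; rewrite in_itv/= => /andP[tt _] Sx; split; last exact: SO.
  exact: lt_le_trans tt.
- apply: measurable_funM.
    have mA : measurable A by exact: measurable_itv.
    have mind : measurable_fun setT (\1_A : measurableTypeR R -> R) by exact: measurable_indic.
    exact: (measurableT_comp mind measurable_fst).
  exact: measurableT_comp (continuous_measurable_rV cpsi) measurable_snd.
- exists `|M| => p; rewrite normrM indicE.
  apply: (@le_trans _ _ (1 * `|psi p.2|)).
    by apply: ler_wpM2r => //; case: (_ \in _); rewrite ?normr1 ?normr0 ?lexx ?ler01.
  by rewrite mul1r; apply: le_trans (psiM _) (ler_norm _).
split; first by apply: measurableX; [exact: measurable_itv|exact: compact_measurable_rV].
move=> f; apply/funext => -[t x]; rewrite !patchE /= indicE.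
have [At|At] := pselect (A t).
  have tt : t1 <= t <= t2 by move: At; rewrite /A/= in_itv/= => /andP[/ltW -> /ltW ->].
  rewrite (mem_set At) mul1r.
  have [Sx|Sx] := pselect (S x).
    have hQ : (`[t1, t2]%classic `*` S) (t, x) by split=> //=; rewrite in_itv.
    have hAO : AO (t, x) by split=> //; exact: SO.
    by rewrite (mem_set hQ) (mem_set hAO).
  rewrite S0// mule0; do 2 case: ifP => //.
rewrite (memNset At) mul0r mule0 [in RHS]memNset; last by case.
by case: ifP.
Qed.

Lemma L1loc_test_integrable (f : spt -> \bar R) : L1loc O f ->
  P.-integrable AO (fun p => f p * (psi p.2)%:E)%E.
Proof.
move=> fL; have [Q [g [cQ QO mg [M gM] [mQ eqQ]]]] := L1loc_test_patch.
apply/(integrable_mkcond _ measurable_itvX); rewrite -eqQ; apply/(integrable_mkcond _ mQ).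
apply: (@integrableMl _ _ _ P _ mQ f g); first exact: fL.
  exact: measurable_funTS.
exists M; split; first exact: num_real.
by move=> N MN x _; exact: le_trans (gM x) (ltW MN).
Qed.

Lemma weak_L1loc_cvg_test (f_ : nat -> spt -> \bar R) (f : spt -> \bar R) :
  weak_L1loc_cvg O f_ f ->
  fine (\int[P]_(p in AO) (f_ k p * (psi p.2)%:E))%E @[k --> \oo] -->
  fine (\int[P]_(p in AO) (f p * (psi p.2)%:E))%E.
Proof.
move=> [fL_ fL cvgf]; have [Q [g [cQ QO mg bg [mQ eqQ]]]] := L1loc_test_patch.
have eqI (F : spt -> \bar R) : (\int[P]_(p in Q) (F p * (g p)%:E) =
    \int[P]_(p in AO) (F p * (psi p.2)%:E))%E.
  by rewrite integral_mkcond eqQ -integral_mkcond.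
have := cvgf Q g cQ QO mg bg; rewrite eqI.
under eq_fun do rewrite eqI.
have fin : (\int[P]_(p in AO) (f p * (psi p.2)%:E))%E \is a fin_num.
  exact: (integrable_fin_num measurable_itvX (L1loc_test_integrable fL)).
by rewrite -{1}(fineK fin) => /fine_cvg.
Qed.

End scalar.

Section gradient.
Variable phi : E -> R.
Hypothesis tphi : test_fun O phi.

Let cgrad i : continuous (fun x => grad phi x ord0 i).
Proof. by apply: test_fun_continuous; exact: test_fun_grad tphi. Qed.

Let sgrad i : compact_support O (fun x => grad phi x ord0 i).
Proof. by apply: test_fun_support; exact: test_fun_grad tphi. Qed.

Lemma L1loc_grad_integrable (F : 'I_d -> spt -> R) :
  (forall i, L1loc O (fun p => (F i p)%:E)) ->
  P.-integrable AO (fun p => (\sum_i F i p * grad phi p.2 ord0 i)%:E).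
Proof.
move=> FL; rewrite (_ : (fun _ => _) =
    (fun p => \sum_i ((F i p)%:E * (grad phi p.2 ord0 i)%:E))%E); last first.
  by apply/funext => p; rewrite -sumEFin.
apply: integrable_sum => [|i _]; first exact: measurable_itvX.
exact: (L1loc_test_integrable (@cgrad i) (@sgrad i) (FL i)).
Qed.

Lemma L1loc_grad_integral (F : 'I_d -> spt -> R) :
  (forall i, L1loc O (fun p => (F i p)%:E)) ->
  fine (\int[P]_(p in AO) (\sum_i F i p * grad phi p.2 ord0 i)%:E)%E =
  \sum_i fine (\int[P]_(p in AO) ((F i p)%:E * (grad phi p.2 ord0 i)%:E))%E.
Proof.
move=> FL.
have iF i := L1loc_test_integrable (@cgrad i) (@sgrad i) (FL i).
rewrite (_ : (fun _ => _) =
    (fun p => \sum_i ((F i p)%:E * (grad phi p.2 ord0 i)%:E))%E); last first.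
  by apply/funext => p; rewrite -sumEFin.
rewrite integral_sum//; last exact: measurable_itvX.
by rewrite -sum_fine// => i _; exact: (integrable_fin_num measurable_itvX (iF i)).
Qed.

(** The flux converges component by component, so the scalar result is applied to each partial
    derivative of [phi] and summed. *)
Lemma weak_L1loc_cvg_grad (F_ : nat -> 'I_d -> spt -> R) (F : 'I_d -> spt -> R) :
  (forall i, weak_L1loc_cvg O (fun k p => (F_ k i p)%:E) (fun p => (F i p)%:E)) ->
  fine (\int[P]_(p in AO) (\sum_i F_ k i p * grad phi p.2 ord0 i)%:E)%E @[k --> \oo] -->
  fine (\int[P]_(p in AO) (\sum_i F i p * grad phi p.2 ord0 i)%:E)%E.
Proof.
move=> cvgF; rewrite L1loc_grad_integral; last by move=> i; case: (cvgF i).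
rewrite (_ : (fun _ => _) = (fun k =>
    \sum_i fine (\int[P]_(p in AO) ((F_ k i p)%:E * (grad phi p.2 ord0 i)%:E))%E)); last first.
  by apply/funext => k; rewrite L1loc_grad_integral// => i; case: (cvgF i).
apply: cvg_big => [|i _]; first exact: add_continuous.
exact: (weak_L1loc_cvg_test (@cgrad i) (@sgrad i) (cvgF i)).
Qed.

End gradient.

End spacetime_test.

(** Isolates the complete steps, which will telescope, from the two incomplete ones at the end
    points. *)
Lemma step_primitive_diff (R : realType) (tau : R) (f g : nat -> R) (t1 t2 : R) :
  let N := step_index tau in (N t1 <= N t2)%N ->
  (step_primitive tau f t2 - step_primitive tau f t1)
    + (step_primitive tau g t2 - step_primitive tau g t1) =
  tau * (\sum_((N t1).+1 <= n < (N t2).+1) (f n + g n))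
  + (((N t1)%:R * tau - t1) * (f (N t1) + g (N t1))
     - ((N t2)%:R * tau - t2) * (f (N t2) + g (N t2))).
Proof.
move=> N N12; rewrite /step_primitive -/(N t1) -/(N t2) big_split/=.
have split (h : nat -> R) : \sum_(n < (N t2).+1) h n =
    \sum_(n < (N t1).+1) h n + \sum_((N t1).+1 <= n < (N t2).+1) h n.
  by rewrite -!(big_mkord xpredT h) (@big_cat_nat _ _ _ (N t1).+1 0).
by rewrite !split; ring.
Qed.

(** * The discrete weak formulation with error bounds *)

Section discrete_weak_form.
Context {R : realType} {d : nat}.
Local Notation E := 'rV[R]_d.
Local Notation fmeas := {finite_measure set E -> \bar R}.
Local Notation leb := (@lebesgue_rV R d).

Variables (O : set E) (U : R -> R) (Psi K : E -> R) (m tau : R).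
Hypotheses (oO : open O) (tau_gt0 : 0 < tau).
Hypothesis energy_ge : forall mu, Mplus O mu -> (m%:E <= energy O U Psi K mu)%E.
Variables (rho0 : fmeas) (rho rhoh : nat -> fmeas) (G : nat -> E -> E).
Hypothesis scheme : splitting_scheme O U Psi K tau rho0 rho rhoh.
Hypothesis rho0_energy : (energy O U Psi K rho0 < +oo)%E.
Hypothesis EL_MK : forall n, euler_lagrange_MK O U Psi K tau (rho n) (rhoh n) (G n).
Hypothesis EL_FR : forall n, euler_lagrange_FR O U Psi K tau (rhoh n) (rho n.+1).

Let mO := open_measurable_rV oO.
Let M : R := 2 * (fine (energy O U Psi K rho0) - m).
Let cost n : R := fine (MK2 (rhoh n) (rho n)).

Lemma scheme_cost_fin n : (MK2 (rhoh n) (rho n) < +oo)%E.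
Proof.
have := scheme_dissipation tau_gt0 energy_ge scheme rho0_energy n.+1.
rewrite big_ord_recr/= => h; apply: le_lt_trans (ltry _); apply: le_trans h.
by rewrite leeDr//; apply: sume_ge0 => i _; exact: MK2_ge0.
Qed.

Lemma scheme_cost_ge0 n : 0 <= cost n.
Proof. by rewrite fine_ge0// MK2_ge0. Qed.

Lemma scheme_cost_sum N : \sum_(n < N) cost n <= tau * M.
Proof.
have := scheme_dissipation tau_gt0 energy_ge scheme rho0_energy N.
rewrite -lee_fin -sumEFin => h; rewrite (_ : tau * M = 2 * tau * (fine (energy O U Psi K rho0) - m)).
  apply: le_trans h; apply: lee_sum => n _; rewrite fineK// ge0_fin_numE ?MK2_ge0//.
  exact: scheme_cost_fin.
by rewrite /M; ring.
Qed.

Lemma scheme_cost_le n : cost n <= tau * M.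
Proof.
apply: le_trans (scheme_cost_sum n.+1); rewrite big_ord_recr/= lerDr.
by apply: sumr_ge0 => i _; exact: scheme_cost_ge0.
Qed.

Variables (phi : E -> R) (C : R).
Hypotheses (tphi : test_fun O phi) (C_ge0 : 0 <= C).
Hypothesis taylor : forall x y,
  `|phi x - phi y - dotv (x - y) (grad phi x)| <= C * sqnorm (x - y).

(** The rate at which the transport substep decreases the integral of [phi], up to the Taylor
    remainder. *)
Definition transport_rate n : R :=
  fine (\int[leb]_(x in O) (dens (rhoh n) x * dotv (G n x) (grad phi x))%:E)%E.

Definition reaction_rate n : R := fine (\int[leb]_(x in O)
  (reaction O U Psi K (dens (rho n.+1)) (dens (rhoh n)) x * (phi x)%:E))%E.

Let a n := \int[rho n]_(x in O) phi x.
Let b n := \int[rhoh n]_(x in O) phi x.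
Let s n := \int[rhoh n]_(x in O) sqnorm (grad phi x).

Lemma reaction_rateE n :
  (\int[leb]_(x in O) (reaction O U Psi K (dens (rho n.+1)) (dens (rhoh n)) x * (phi x)%:E)
   = (reaction_rate n)%:E)%E /\ tau * reaction_rate n = b n - a n.+1.
Proof.
have [_ /(_ n)[_ _ ac _ ac1]] := scheme.
rewrite /reaction_rate (euler_lagrange_FR_real oO tau_gt0 tphi ac ac1 (EL_FR n)).
by split=> //=; rewrite mulrN mulrA mulfV ?gt_eqF// mul1r opprB.
Qed.

(** The Taylor bound serves the complete steps, where the costs are summed; the Young bound, with
    free scale [e], serves the incomplete ones. *)
Lemma transport_rateE n :
  [/\ (\int[leb]_(x in O) (dens (rhoh n) x * dotv (G n x) (grad phi x))%:E
       = (transport_rate n)%:E)%E,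
      `|b n - a n + tau * transport_rate n| <= C * cost n &
      forall e, 0 < e -> `|tau * transport_rate n| <= e * s n + e^-1 * cost n].
Proof.
have [_ /(_ n)[_ _ ac _ _]] := scheme; have [wG [T optT EL]] := EL_MK n.
have mu := scheme_Mplus_half scheme n; have nu := scheme_Mplus scheme n.
have fin := scheme_cost_fin n.
rewrite /transport_rate (euler_lagrange_MK_real oO tphi mu ac fin wG optT EL).
split=> //=; rewrite mulrN mulrA mulfV ?gt_eqF// mul1r.
  exact: (taylor_optimal mO mu nu optT fin tphi taylor).
by move=> e e0; rewrite normrN; exact: (young_optimal mO mu optT fin tphi e0).
Qed.

Let h n := transport_rate n + reaction_rate n.

(** The reaction balance is exact, so the intermediate value [b n] cancels and only the transport
    error remains. *)
Let step_balance n : `|tau * h n + (a n.+1 - a n)| <= C * cost n.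
Proof.
have [_ Hr] := reaction_rateE n; have [_ H _] := transport_rateE n.
rewrite /h mulrDr Hr; apply: le_trans H; rewrite le_eqVlt; apply/orP; left.
by apply/eqP; congr `|_|; ring.
Qed.

(** Bound for one incomplete step: Young's inequality for its transport part, the jump between the
    two interpolated curves for its reaction part. *)
Let boundary t := Num.sqrt tau * (s (step_index tau t) + M)
  + `|b (step_index tau t) - a (step_index tau t).+1|.

Let boundary_le (t theta : R) : `|theta| <= tau ->
  `|theta * h (step_index tau t)| <= boundary t.
Proof.
move=> th; rewrite /boundary; set n := step_index tau t.
rewrite normrM; apply: (@le_trans _ _ (tau * `|h n|)); first exact: ler_wpM2r.
rewrite -[X in X * _](gtr0_norm tau_gt0) -normrM /h mulrDr; apply: le_trans (ler_normD _ _) _.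
have [_ ->] := reaction_rateE n; rewrite lerD2r.
(* Young's inequality at scale sqrt tau, as the cost of one step is O(tau) *)
have st0 : 0 < Num.sqrt tau by rewrite sqrtr_gt0.
have [_ _ /(_ _ st0) H] := transport_rateE n; apply: le_trans H _.
rewrite mulrDr lerD2l -(ler_pM2l st0) mulrA mulfV ?gt_eqF// mul1r.
have -> : Num.sqrt tau * (Num.sqrt tau * M) = tau * M.
  by rewrite mulrA -expr2 sqr_sqrtr// ltW.
exact: scheme_cost_le.
Qed.

Lemma discrete_weak_form t1 t2 : 0 <= t1 -> t1 <= t2 ->
  `|(step_primitive tau transport_rate t2 - step_primitive tau transport_rate t1)
    + (step_primitive tau reaction_rate t2 - step_primitive tau reaction_rate t1)
    + (a (step_index tau t2).+1 - a (step_index tau t1).+1)|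
  <= C * (tau * M) + (boundary t1 + boundary t2).
Proof.
move=> t10 t12; have t20 := le_trans t10 t12.
(* Monotonicity of the index: a smaller index at [t2] would place [t2] at or before the grid point
   that opens the step of [t1]. *)
have N12 : (step_index tau t1 <= step_index tau t2)%N.
  rewrite leqNgt; apply/negP => lt21.
  have [|] := step_index_lt tau_gt0 t10; last by move=> h0; rewrite h0 in lt21.
  move=> H; have H2 := step_index_ge tau_gt0 t20.
  have H3 : (step_index tau t2)%:R * tau <= ((step_index tau t1)%:R - 1) * tau.
    by rewrite ler_pM2r// lerBrDr natr1 ler_nat.
  by have := lt_le_trans H (le_trans t12 (le_trans H2 H3)); rewrite ltxx.
set N1 := step_index tau t1; set N2 := step_index tau t2.
have key : `|tau * (\sum_(N1.+1 <= n < N2.+1) h n) + (a N2.+1 - a N1.+1)| <= C * (tau * M).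
  (* The increment of [a] is spread over the steps, so that each one contributes its own balance. *)
  rewrite -telescope_sumr// mulr_sumr -big_split/=.
  apply: le_trans (ler_norm_sum _ _ _) _.
  apply: (@le_trans _ _ (\sum_(N1.+1 <= n < N2.+1) C * cost n)).
    by apply: ler_sum => n _; exact: step_balance.
  rewrite -mulr_sumr; apply: ler_wpM2l => //; apply: le_trans (scheme_cost_sum N2.+1).
  rewrite -(big_mkord xpredT cost) (@big_cat_nat _ _ _ N1.+1 0)//= lerDr.
  by apply: sumr_ge0 => n _; exact: scheme_cost_ge0.
have th1 := @boundary_le t1 _ (step_index_theta tau_gt0 t10).
have th2 := @boundary_le t2 _ (step_index_theta tau_gt0 t20).
rewrite -/N1 -/N2 in th1 th2 *.
rewrite (step_primitive_diff _ _ N12) -/N1 -/N2 addrAC.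
apply: le_trans (ler_normD _ _) _; apply: lerD => //.
by apply: le_trans (ler_normB _ _) _; apply: lerD.
Qed.

End discrete_weak_form.

(** * Passage to the limit: auxiliary facts *)

Section limits.
Context {R : realType} {d : nat}.
Local Notation E := 'rV[R]_d.
Local Notation fmeas := {finite_measure set E -> \bar R}.
Local Notation leb := (@lebesgue_rV R d).
Variable O : set E.
Hypothesis oO : open O.
Let mO := open_measurable_rV oO.

Lemma cvg0_unique (x_ e_ : nat -> R) (x : R) : x_ k @[k --> \oo] --> x ->
  e_ k @[k --> \oo] --> 0 -> (forall k, `|x_ k| <= e_ k) -> x = 0.
Proof.
move=> xx e0 xe; apply: (@cvg_unique _ _ (x_ k @[k --> \oo])) => //.
apply: norm_cvg0; apply: (@squeeze_cvgr _ _ _ _ (fun=> 0) e_) => //.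
  by apply: nearW => k; rewrite xe normr_ge0.
exact: cvg_cst.
Qed.

Lemma cvg_sqrt0 (tau : nat -> R) : tau k @[k --> \oo] --> 0 ->
  Num.sqrt (tau k) @[k --> \oo] --> 0.
Proof.
by move=> t0; rewrite -[X in _ --> X](sqrtr0 R); apply: continuous_cvg t0; exact: sqrt_continuous.
Qed.

Lemma weak_star_cvg_Rintegral (mu_ : nat -> fmeas) (mu : fmeas) (f : E -> R) :
  weak_star_cvg O mu_ mu -> continuous f ->
  (forall e : R, 0 < e -> exists Q, [/\ compact Q, Q `<=` O &
       forall x, ~ Q x -> `|f x| < e]) ->
  \int[mu_ k]_(x in O) f x @[k --> \oo] --> \int[mu]_(x in O) f x.
Proof.
move=> mumu cf f0; have [Q [cQ QO Qf]] := f0 1 ltr01.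
have bf : exists M, forall x, `|f x| <= M.
  by apply: (bounded_off_compact (c := 1) cf cQ) => x /Qf /ltW.
have fi (m : fmeas) := bounded_integrable m mO (continuous_measurable_rV cf) bf.
apply: fine_cvg; rewrite fineK; last exact: (integrable_fin_num mO (fi mu)).
apply: mumu; first exact: continuous_subspaceT.
by move=> e e0; have [Q' [cQ' Q'O Q'f]] := f0 e e0; exists Q'; split=> // x _; exact: Q'f.
Qed.

Lemma weak_star_cvg_Rintegral_support (mu_ : nat -> fmeas) (mu : fmeas) (f : E -> R) :
  weak_star_cvg O mu_ mu -> continuous f -> compact_support O f ->
  \int[mu_ k]_(x in O) f x @[k --> \oo] --> \int[mu]_(x in O) f x.
Proof.
move=> mumu cf [Q [cQ QO Qf]]; apply: weak_star_cvg_Rintegral => // e e0.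
by exists Q; split=> // x Qx; rewrite Qf// normr0.
Qed.

Lemma KFR_holder_continuous (rho : R -> fmeas) : KFR_holder_half O rho -> KFR_continuous O rho.
Proof.
move=> [C HC] t t0; apply: (@squeeze_cvge _ _ _ _ (fun=> 0%E) _ (fun s => (C * Num.sqrt `|s - t|)%:E)).
- rewrite near_withinE; apply: nearW => s s0; rewrite HC// andbT.
  exact: sqrte_ge0.
- exact: cvg_cst.
- apply: cvg_within_filter; apply: cvg_EFin; first exact: nearW.
  have ct : `|s - t| @[s --> t] --> (0 : R).
    rewrite -(normr0 R) -(subrr t); apply: cvg_norm.
    by apply: cvgB; [exact: cvg_id|exact: cvg_cst].
  have cs : Num.sqrt `|s - t| @[s --> t] --> (0 : R).
    by rewrite -(sqrtr0 R); apply: continuous_cvg ct; exact: sqrt_continuous.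
  by rewrite -(mulr0 C); apply: cvgM cs; exact: cvg_cst.
Qed.

(** Links a space-time integral of an interpolated quantity with the discrete sums: by Fubini the
    slices form a step function of time. *)
Lemma slice_integral (tau t1 t2 : R) (F : measurableTypeR R * E -> \bar R) (h : nat -> R) :
  0 < tau -> 0 < t1 -> t1 < t2 ->
  (@lebesgue_measure R \x leb)%E.-integrable (`]t1, t2[%classic `*` O) F ->
  (forall t, 0 < t ->
    (\int[leb]_(x in O) F (t, x) = (h (step_index tau t))%:E)%E) ->
  fine (\int[(@lebesgue_measure R \x leb)%E]_(p in `]t1, t2[%classic `*` O) F p)%E =
  step_primitive tau h t2 - step_primitive tau h t1.
Proof.
move=> tau0 t10 t12 iF FE; rewrite integral_rectangle//.
have [mh intE] := integral_step tau0 h (ltW t10) (ltW t12).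
rewrite -[RHS]/(fine (step_primitive tau h t2 - step_primitive tau h t1)%:E) -intE; congr fine.
have moo : measurable_fun `]t1, t2[%classic (EFin \o (fun t => h (step_index tau t))).
  apply/measurable_EFinP; apply: (measurable_funS _ _ mh) => //.
  by apply: subset_itvl; rewrite bnd_simp.
(* The step function is integrated over []t1, t2]] and the slab over []t1, t2[]; the end point is
   negligible. *)
rewrite [RHS](integral_itv_bndoo false false moo).
apply: eq_integral => t; rewrite inE /= in_itv/= => /andP[t1t _].
by rewrite FE// (lt_trans t10).
Qed.

End limits.

(** * Limit of the scheme: initial datum and weak formulation *)

Section convergence.
Context {R : realType} {d : nat}.
Local Notation E := 'rV[R]_d.
Local Notation fmeas := {finite_measure set E -> \bar R}.
Local Notation leb := (@lebesgue_rV R d).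
Local Notation P := (@lebesgue_measure R \x leb)%E.

Variables (O : set E) (U : R -> R) (Psi K : E -> R) (m : R).
Hypothesis oO : open O.
Hypothesis energy_ge : forall mu, Mplus O mu -> (m%:E <= energy O U Psi K mu)%E.
Variables (rho0 : fmeas) (tau : nat -> R) (rhon rhoh : nat -> nat -> fmeas).
Variable Gh : nat -> nat -> E -> E.
Hypothesis rho0_energy : (energy O U Psi K rho0 < +oo)%E.
Hypotheses (tau_gt0 : forall k, 0 < tau k) (tau_cvg0 : tau k @[k --> \oo] --> 0).
Hypothesis scheme : forall k, splitting_scheme O U Psi K (tau k) rho0 (rhon k) (rhoh k).
Hypothesis EL_MK : forall k n,
  euler_lagrange_MK O U Psi K (tau k) (rhon k n) (rhoh k n) (Gh k n).
Hypothesis EL_FR : forall k n,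
  euler_lagrange_FR O U Psi K (tau k) (rhoh k n) (rhon k n.+1).
Variable rho : R -> fmeas.
Hypothesis rho_Mplus : forall t, 0 <= t -> Mplus O (rho t).
Hypothesis rhotau_cvg : forall t, 0 <= t ->
  weak_star_cvg O (fun k => rhon k (step_index (tau k) t).+1) (rho t).
Hypothesis rhottau_cvg : forall t, 0 <= t ->
  weak_star_cvg O (fun k => rhoh k (step_index (tau k) t)) (rho t).

Let mO := open_measurable_rV oO.
Let M : R := 2 * (fine (energy O U Psi K rho0) - m).

Lemma initial_datum : meas_eq (rho 0) rho0.
Proof.
have rho0O : Mplus O rho0.
  by have := scheme_Mplus (scheme 0) 0%N; have [-> _] := scheme 0.
apply: (Mplus_unique_lipschitz oO) => //; first exact: rho_Mplus.
move=> f L Lf f0; have cf := lipschitz_continuous Lf.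
have [Q [cQ QO Qf]] := f0 1 ltr01.
have bf : exists M, forall x, `|f x| <= M.
  by apply: (bounded_off_compact (c := 1) cf cQ) => x /Qf /ltW.
have fi (mu : fmeas) := bounded_integrable mu mO (continuous_measurable_rV cf) bf.
rewrite -(fineK (integrable_fin_num mO (fi (rho 0)))) -(fineK (integrable_fin_num mO (fi rho0))).
congr EFin; apply/eqP; rewrite -subr_eq0; apply/eqP.
have cvgf := weak_star_cvg_Rintegral oO (rhottau_cvg (lexx 0)) cf f0.
(* The error comes from [lipschitz_optimal] with [e = sqrt tau]: the cost of one step is at most
   [tau * M], so both of its terms are of order [sqrt tau]. *)
apply: (@cvg0_unique _
  (fun k => \int[rhoh k (step_index (tau k) 0)]_(x in O) f x - \int[rho0]_(x in O) f x)
  (fun k => `|L| * (Num.sqrt (tau k) * (fine (rho0 setT) + M)))).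
- by apply: cvgB cvgf _; exact: cvg_cst.
- rewrite -(mulr0 `|L|) -(mul0r (fine (rho0 setT) + M)); apply: cvgM; first exact: cvg_cst.
  by apply: cvgM; [exact: cvg_sqrt0|exact: cvg_cst].
move=> k; have -> : step_index (tau k) 0 = 0%N by rewrite /step_index mul0r ceil0.
have st0 : 0 < Num.sqrt (tau k) by rewrite sqrtr_gt0.
have [rhoE _] := scheme k.
have [_ [T optT _]] := EL_MK k 0.
have Lf' x y : `|f x - f y| <= `|L| * `|x - y|.
  by apply: le_trans (Lf x y) _; apply: ler_wpM2r => //; exact: ler_norm.
have := lipschitz_optimal mO (scheme_Mplus_half (scheme k) 0) (scheme_Mplus (scheme k) 0)
  optT (scheme_cost_fin (tau_gt0 k) energy_ge (scheme k) rho0_energy 0)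
  (normr_ge0 L) st0 bf Lf'.
rewrite rhoE => h; apply: le_trans h _; apply: ler_wpM2l => //.
have mass : rhoh k 0 setT = rho0 setT.
  by have := scheme_mass_half (scheme k) 0; rewrite rhoE.
rewrite mass mulrDr lerD2l -(ler_pM2l st0) mulrA mulfV ?gt_eqF// mul1r.
have -> : Num.sqrt (tau k) * (Num.sqrt (tau k) * M) = tau k * M.
  by rewrite mulrA -expr2 sqr_sqrtr// ltW.
by have := scheme_cost_le (tau_gt0 k) energy_ge (scheme k) rho0_energy 0; rewrite rhoE.
Qed.

Variables (u : R -> E -> R) (G : R -> E -> E).
Hypothesis flux_cvg : forall i : 'I_d,
  weak_L1loc_cvg O
    (fun k p => (dens (rhoh k (step_index (tau k) p.1)) p.2
       * Gh k (step_index (tau k) p.1) p.2 ord0 i)%:E)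
    (fun p => (u p.1 p.2 * G p.1 p.2 ord0 i)%:E).
Hypothesis reaction_cvg : weak_L1loc_cvg O
  (fun k p => reaction O U Psi K (dens (rhon k (step_index (tau k) p.1).+1))
     (dens (rhoh k (step_index (tau k) p.1))) p.2)
  (fun p => (u p.1 p.2)%:E * potential O U Psi K (u p.1) p.2)%E.

Lemma limit_weak_form t1 t2 phi : 0 < t1 -> t1 < t2 -> test_fun O phi ->
  fine (\int[P]_(p in `]t1, t2[%classic `*` O)
    (\sum_i (u p.1 p.2 * G p.1 p.2 ord0 i) * grad phi p.2 ord0 i)%:E)%E
  + fine (\int[P]_(p in `]t1, t2[%classic `*` O)
    ((u p.1 p.2)%:E * potential O U Psi K (u p.1) p.2 * (phi p.2)%:E))%E
  + (\int[rho t2]_(x in O) phi x - \int[rho t1]_(x in O) phi x) = 0.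
Proof.
move=> t10 t12 tphi; have t20 := lt_trans t10 t12.
have cphi := test_fun_continuous tphi; have sphi := test_fun_support tphi.
have [C C0 taylor] := taylor_test_fun tphi.
have cvg1 := weak_L1loc_cvg_grad (t2 := t2) oO t10 tphi flux_cvg.
have cvg2 := weak_L1loc_cvg_test (t2 := t2) oO t10 cphi sphi reaction_cvg.
have cgrad : continuous (fun x => sqnorm (grad phi x)).
  by apply: continuous_dotv => i; apply: test_fun_continuous; exact: test_fun_grad tphi.
have cvga t (t0 : 0 < t) := weak_star_cvg_Rintegral_support oO (rhotau_cvg (ltW t0)) cphi sphi.
have cvgb t (t0 : 0 < t) := weak_star_cvg_Rintegral_support oO (rhottau_cvg (ltW t0)) cphi sphi.
have cvgs t (t0 : 0 < t) := weak_star_cvg_Rintegral_support oO (rhottau_cvg (ltW t0))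
  cgrad (grad_support tphi).
(* The boundary error at time [t]. It tends to 0 because the integrals of [sqnorm (grad phi)]
   converge and the two interpolated curves have the same limit. *)
pose bd t k := Num.sqrt (tau k)
    * (\int[rhoh k (step_index (tau k) t)]_(x in O) sqnorm (grad phi x) + M)
  + `|\int[rhoh k (step_index (tau k) t)]_(x in O) phi x
      - \int[rhon k (step_index (tau k) t).+1]_(x in O) phi x|.
have bd0 t : 0 < t -> bd t k @[k --> \oo] --> 0.
  move=> t0; rewrite -(addr0 0); apply: cvgD.
    rewrite -[X in _ --> X](mul0r (\int[rho t]_(x in O) sqnorm (grad phi x) + M)).
    apply: cvgM; first exact: cvg_sqrt0.
    by apply: cvgD; [exact: cvgs|exact: cvg_cst].
  rewrite -(normr0 R) -(subrr (\int[rho t]_(x in O) phi x)).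
  by apply: cvg_norm; apply: cvgB; [exact: cvgb|exact: cvga].
apply: (cvg0_unique (cvgD (cvgD cvg1 cvg2) (cvgB (cvga t2 t20) (cvga t1 t10)))
  (e_ := fun k => C * (tau k * M) + (bd t1 k + bd t2 k))).
  rewrite -[X in _ --> X](addr0 0); apply: cvgD; last first.
    by rewrite -(addr0 0); apply: cvgD; exact: bd0.
  rewrite -(mulr0 C); apply: cvgM; first exact: cvg_cst.
  by rewrite -(mul0r M); apply: cvgM; [exact: tau_cvg0|exact: cvg_cst].
move=> k /=.
(* Local integrability of the discrete fluxes is part of the weak convergence assumption; Fubini
   needs it. *)
have i1 := L1loc_grad_integrable t2 oO t10 tphi
  (F := fun i p => dens (rhoh k (step_index (tau k) p.1)) p.2
       * Gh k (step_index (tau k) p.1) p.2 ord0 i).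
have {}i1 := i1 (fun i => let: And3 h _ _ := flux_cvg i in h k).
have i2 := L1loc_test_integrable t2 oO t10 cphi sphi
  (let: And3 h _ _ := reaction_cvg in h k).
have rE n := transport_rateE oO (tau_gt0 k) energy_ge (scheme k) rho0_energy (EL_MK k) tphi taylor n.
have qE n := reaction_rateE oO (tau_gt0 k) (scheme k) (EL_FR k) tphi n.
have e1 : fine (\int[P]_(p in `]t1, t2[%classic `*` O) _)%E = _ :=
  slice_integral oO (h := transport_rate O (rhoh k) (Gh k) phi) (tau_gt0 k) t10 t12 i1 _.
have e2 : fine (\int[P]_(p in `]t1, t2[%classic `*` O) _)%E = _ :=
  slice_integral oO (h := reaction_rate O U Psi K (rhon k) (rhoh k) phi)
    (tau_gt0 k) t10 t12 i2 _.
have := discrete_weak_form oO (tau_gt0 k) energy_ge (scheme k) rho0_energy (EL_MK k) (EL_FR k)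
  tphi C0 taylor (ltW t10) (ltW t12).
(* What remains is that the slice at time [t] integrates to the rate of the step containing [t]. *)
rewrite -e1; first rewrite -e2; first exact.
- by move=> t _; have [<- _] := qE (step_index (tau k) t).
- move=> t _; have [<- _ _] := rE (step_index (tau k) t).
  apply: eq_integral => x _ /=; congr EFin.
  by rewrite /dotv mulr_sumr; apply: eq_bigr => i _; rewrite mulrA.
Qed.

End convergence.

(** * Assembly of the weak solution *)

Local Open Scope ereal_scope.

Theorem theorem4 (R : realType) (d : nat) (hd : (0 < d)%N)
    (O : set 'rV[R]_d) (O_open : open O)
    (O_convex : convex_set (O : set (convex_lmodType 'rV[R]_d)))
    (U : R -> R) (Psi K : 'rV[R]_d -> R)
    (U_diff : differentiable_energy U)
    (first_var : first_variation O U Psi K)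
    (rho0 : {finite_measure set 'rV[R]_d -> \bar R})
    (rho0_M2 : Mplus2 O rho0)
    (rho0_energy : energy O U Psi K rho0 < +oo)
    (energy_bounded : exists m : R, forall mu, Mplus O mu ->
       m%:E <= energy O U Psi K mu)
    (tau : nat -> R) (tau_gt0 : forall k, (0 < tau k)%R)
    (tau_cvg0 : tau k @[k --> \oo] --> 0%R)
    (rhon rhoh : nat -> nat -> {finite_measure set 'rV[R]_d -> \bar R})
    (scheme : forall k,
       splitting_scheme O U Psi K (tau k) rho0 (rhon k) (rhoh k))
    (Gh : nat -> nat -> 'rV[R]_d -> 'rV[R]_d)
    (EL_MK : forall k n,
       euler_lagrange_MK O U Psi K (tau k) (rhon k n) (rhoh k n) (Gh k n))
    (EL_FR : forall k n,
       euler_lagrange_FR O U Psi K (tau k) (rhoh k n) (rhon k n.+1))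
    (rho : R -> {finite_measure set 'rV[R]_d -> \bar R})
    (rho_Mplus : forall t, (0 <= t)%R -> Mplus O (rho t))
    (rho_holder : KFR_holder_half O rho) :
  let rhotau k := interpolate (tau k) (fun n => rhon k n.+1) in
  let rhottau k := interpolate (tau k) (rhoh k) in
  let Gtau k := interpolate (tau k) (Gh k) in
  (forall t, (0 <= t)%R -> weak_star_cvg O (fun k => rhotau k t) (rho t)) ->
  (forall t, (0 <= t)%R -> weak_star_cvg O (fun k => rhottau k t) (rho t)) ->
  forall (u : R -> 'rV[R]_d -> R) (G : R -> 'rV[R]_d -> 'rV[R]_d),
  density_gradient O U Psi K rho u G ->
  (forall i : 'I_d,
     weak_L1loc_cvg O
       (fun k p => (dens (rhottau k p.1) p.2 * Gtau k p.1 p.2 ord0 i)%:E)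
       (fun p => (u p.1 p.2 * G p.1 p.2 ord0 i)%:E)) ->
  weak_L1loc_cvg O
    (fun k p =>
       reaction O U Psi K (dens (rhotau k p.1)) (dens (rhottau k p.1)) p.2)
    (fun p => (u p.1 p.2)%:E * potential O U Psi K (u p.1) p.2) ->
  weak_solution O U Psi K rho0 rho.
Proof.
move=> rhotau rhottau Gtau cvg_rho cvg_rhot u G dgr flux_cvg reaction_cvg.
have [m energy_ge] := energy_bounded.
split=> //; last exact: KFR_holder_continuous.
  exists u, G; split=> // t1 t2 phi t10 t12 tphi integrand.
  have cphi := test_fun_continuous tphi; have sphi := test_fun_support tphi.
  pose P := (@lebesgue_measure R \x @lebesgue_rV R d)%E.
  (* The transport part is written componentwise, the form in which the flux converges; [F2] is the
     reaction part. *)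
  pose F1 (p : measurableTypeR R * 'rV[R]_d) :=
    (\sum_i (u p.1 p.2 * G p.1 p.2 ord0 i) * grad phi p.2 ord0 i)%:E.
  pose F2 (p : measurableTypeR R * 'rV[R]_d) :=
    (u p.1 p.2)%:E * potential O U Psi K (u p.1) p.2 * (phi p.2)%:E.
  have integrandE p : integrand p.1 p.2 = F1 p + F2 p.
    congr (_%:E + _); rewrite /dotv mulr_sumr.
    by apply: eq_bigr => i _; rewrite mulrA.
  have mAO := measurable_itvX t1 t2 O_open.
  have i1 : P.-integrable (`]t1, t2[%classic `*` O) F1.
    apply: (L1loc_grad_integrable t2 O_open t10 tphi
      (F := fun i p => (u p.1 p.2 * G p.1 p.2 ord0 i)%R)) => i.
    by case: (flux_cvg i).
  have i2 : P.-integrable (`]t1, t2[%classic `*` O) F2.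
    apply: (L1loc_test_integrable t2 O_open t10 cphi sphi
      (f := fun p => (u p.1 p.2)%:E * potential O U Psi K (u p.1) p.2)).
    by case: reaction_cvg.
  have i12 : P.-integrable (`]t1, t2[%classic `*` O) (fun p => integrand p.1 p.2).
    rewrite (_ : (fun _ => _) = F1 \+ F2); last by apply/funext => p; rewrite integrandE.
    exact: integrableD.
  split=> //.
  have -> : \int[lebesgue_measure]_(t in `]t1, t2[) \int[lebesgue_rV d]_(x in O) integrand t x =
      \int[P]_(p in `]t1, t2[%classic `*` O) F1 p + \int[P]_(p in `]t1, t2[%classic `*` O) F2 p.
    rewrite -integralD//; under [RHS]eq_integral do rewrite -integrandE.
    by rewrite (integral_rectangle _ _ i12)//; exact: open_measurable_rV.
  have fphi (mu : {finite_measure set 'rV[R]_d -> \bar R}) :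
      \int[mu]_(x in O) (phi x)%:E = (\int[mu]_(x in O) phi x)%R%:E.
    have mO := open_measurable_rV O_open.
    rewrite /Rintegral fineK//; apply: (integrable_fin_num mO).
    by apply: bounded_integrable => //; [exact: test_fun_measurable tphi|exact: test_fun_bounded tphi].
  have := limit_weak_form O_open energy_ge rho0_energy tau_gt0 tau_cvg0 scheme EL_MK EL_FR
    cvg_rho cvg_rhot flux_cvg reaction_cvg t10 t12 tphi.
  rewrite -/F1 -/F2 !fphi.
  rewrite -(fineK (integrable_fin_num mAO i1)) -(fineK (integrable_fin_num mAO i2)).
  move=> H; rewrite -EFinB -EFinD -EFinN; congr EFin.
  by apply/eqP; rewrite -subr_eq0 opprK addrC; apply/eqP.
exact: (initial_datum O_open energy_ge rho0_energy tau_gt0 tau_cvg0 scheme EL_MK rho_Mplus cvg_rhot).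
Qed.
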